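(* Let $n\in\mathbb{N}$ and let $p$ be a prime. Let $Q\in\mathrm{Syl}_p(A_n)$ and let $\eta,\theta\in\mathrm{Irr}(A_n)$. If $\mathrm{Van}(\eta\downarrow_Q)\subseteq\mathrm{Van}(\theta\downarrow_Q)$, then $$\begin{cases}\eta(1)_p\le\theta(1)_p&\text{if }p\text{ is odd};\\ \eta(1)_2\le2\cdot\theta(1)_2&\text{if }p=2.\end{cases}$$ In particular, suppose $\mathrm{Van}(\eta\downarrow_Q)=\mathrm{Van}(\theta\downarrow_Q)$; if $p$ is odd, then $\eta(1)_p=\theta(1)_p$, while if $p=2$ and (without loss of generality) $\eta(1)_2\ge\theta(1)_2$, then $\eta(1)_2\in\{\theta(1)_2,\,2\cdot\theta(1)_2\}$.
   Context: $\mathrm{Irr}(G)$ denotes the set of irreducible complex characters of a finite group $G$, and $\eta\downarrow_Q$ is the restriction of $\eta$ to $Q$. For a character $\xi$ of a finite group $G$, $\mathrm{Van}(\xi)=\{g\in G\mid \xi(g)=0\}$; thus $\mathrm{Van}(\eta\downarrow_Q)=\{g\in Q\mid\eta(g)=0\}$. For an integer $m\ge1$, $m_p$ is the largest power of $p$ dividing $m$. *)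

(* Defs.v *)
From mathcomp Require Import all_boot all_order all_algebra all_fingroup.
From mathcomp Require Import all_solvable all_field all_character.

Set Implicit Arguments.
Unset Strict Implicit.
Unset Printing Implicit Defensive.

Import GRing.Theory Num.Theory GroupScope.

(* Class functions on G are total functions on gT that are zero outside of G,
   hence the explicit restriction to g \in G. *)
Definition Van (gT : finGroupType) (G : {group gT}) (xi : 'CF(G)) : {set gT} :=
  [set g in G | xi g == 0%R].

(* The degree xi(1) as a natural number: truncn is the inverse of the embedding
   of nat into algC, and xi 1 is in its image when xi is a character; see
   chardegK. *)
Definition chardeg (gT : finGroupType) (G : {group gT}) (xi : 'CF(G)) : nat :=
  Num.truncn (xi 1%g).

Lemma chardegK (gT : finGroupType) (G : {group gT}) (xi : 'CF(G)) :
  xi \is a character -> ((chardeg xi)%:R = xi 1%g)%R.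
Proof. by move=> Nxi; apply: truncnK; apply: Cnat_char1. Qed.

(* Main.v *)
Require Import Defs.
From mathcomp Require Import all_boot all_order all_algebra all_fingroup.
From mathcomp Require Import all_solvable all_field all_character.
From mathcomp Require Import zify ring.

(* For a p-element g of S_n let s(g) be the sum over the cycles c of g of
   (|c| - 1) / (p - 1), i.e., of v_p(|c|!) (this is cycle_weight p g).

   (1) If f is a character of a p-group P of permutations, and D bounds s(g) for
   all g in P with f(g) != 0, then |P| divides p^D f(1). Indeed, there are
   polynomials A_J with integral coefficients and degree at most v_p((p^J)!),
   with A_0 = 1 and A_J(-1/p) = 0 for J > 0, whose values at a root of unity are
   the power sums of order p^J of a fixed family of algebraic integers. Then
   h = 1/|P| sum_g f(g) prod_(c cycle of g) A_(log_p |c|) takes algebraic integer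
   values at roots of unity, because prod_c A is there a weighted permutation
   character. As h has degree at most D, it follows that f(1)/|P| = h(-1/p) has
   p-adic valuation at least -D.

   (2) If chi is an irreducible character of S_n and chi(g) != 0, then
   v_p(chi(1)) + s(g) <= v_p(n!). Encoding partitions by beta-sets l, chi is, up
   to sign, g |-> sum_w eps(l - content(w)), for w ranging over the words fixed by
   g and eps the antisymmetrised indicator of (0, ..., n - 1). Removing the cycles
   of g whose length is divisible by q = p^k bounds from below the q-weight
   sum_i l_i / q - #{i < j : l_i = l_j mod q}, and the sum of these weights over
   all k > 0 is v_p(n! / chi(1)), by the degree formula.

   (3) The bound (2) passes to A_n. The only difficulty is a g at which the two
   constituents of chi take opposite nonzero values; then g commutes with no odd
   permutation. This is impossible for p = 2, and for odd p the difference of the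
   two constituents, restricted to a Sylow p-subgroup, is supported by one S_n-class,
   so that its norm makes |C(g)| divide |eta(g)|^2, against column orthogonality.

   Given theta, (1) yields an element g of Q at which theta, hence eta, does not
   vanish, and (3) bounds eta(1)_p in terms of s(g). The factor 2 is |S_n : A_n|. *)

Set Implicit Arguments.
Unset Strict Implicit.
Unset Printing Implicit Defensive.

Import Order.TTheory GRing.Theory Num.Theory GroupScope.
Local Open Scope ring_scope.

(** * Words, contents and cycles *)

Section Words.
Variables (T L : finType).
Implicit Types (w : {ffun T -> L}) (g : {perm T}).

Definition word_act w g : {ffun T -> L} := [ffun i => w (g^-1%g i)].

Lemma word_act1 : word_act^~ 1%g =1 id.
Proof. by move=> w; apply/ffunP=> i; rewrite ffunE invg1 perm1. Qed.

Lemma word_actM w : act_morph word_act w.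
Proof. by move=> g h; apply/ffunP=> i; rewrite !ffunE invMg permM. Qed.

Canonical word_action := TotalAction word_act1 word_actM.

Definition fixes_word g w := [forall i, w (g i) == w i].

Lemma fixes_wordE g w : fixes_word g w = (word_act w g == w).
Proof.
apply/forallP/eqP => [fw | E i]; last by rewrite -{1}E ffunE permK.
by apply/ffunP=> i; rewrite ffunE -(eqP (fw _)) permKV.
Qed.

Definition content w : {ffun L -> nat} := [ffun x => \sum_i (w i == x)]%N.

Lemma content_act w g : content (word_act w g) = content w.
Proof.
apply/ffunP=> x; rewrite !ffunE (reindex_inj (@perm_inj _ g)) /=.
by apply: eq_bigr => i _; rewrite ffunE permK.
Qed.

(* Each orbit of words contributes its weight times the multiplicity of the
   trivial character in the restriction of f to a stabiliser. *)
Lemma weighted_words (G : {group {perm T}}) (f : 'CF(G)) :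
    f \is a character ->
  exists s : seq (nat * {ffun T -> L}), forall wt : {ffun T -> L} -> algC,
    (forall w g, g \in G -> wt (word_act w g) = wt w) ->
  \sum_(g in G) f g * (\sum_(w | fixes_word g w) wt w)
     = #|G|%:R * \sum_(x <- s) x.1%:R * wt x.2.
Proof.
move=> Nf.
pose st w := 'C_G[w | word_action]%G.
have stE w g : (g \in st w) = (g \in G) && fixes_word g w.
  rewrite /= inE; case: (g \in G) => //=.
  by rewrite fixes_wordE; apply/astab1P/eqP.
have sSG w : st w \subset G by rewrite subIset ?subxx.
pose nf w := '['Res[st w] f, 1].
have nfN w : nf w \is a Num.nat.
  by apply: Cnat_cfdot_char; [apply: cfRes_char | apply: cfun1_char].
have nfE w : \sum_(g in st w) f g = #|st w|%:R * nf w.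
  rewrite /nf cfdotE mulrA mulfV ?mul1r; last first.
    by rewrite pnatr_eq0 -lt0n cardG_gt0.
  apply: eq_bigr => g sg.
  by rewrite cfun1E sg rmorph1 mulr1 cfResE.
have nfJ w y : y \in G ->
    \sum_(g in st (word_act w y)) f g = \sum_(g in st w) f g.
  move=> Gy; rewrite (reindex_inj (conjg_inj y)) /=.
  apply: eq_big => [g | g _]; last by rewrite cfunJ.
  rewrite !stE groupJr // !fixes_wordE -!word_actM.
  rewrite conjgE !mulgA mulgV mul1g word_actM.
  by rewrite (inj_eq (act_inj word_action y)).
pose P := orbit word_action G @: [set: {ffun T -> L}].
have trP : partition P [set: {ffun T -> L}].
  by apply: orbit_partition; apply/actsP => g _ w; rewrite !inE.
case: (pickP (mem [set: {ffun T -> L}])) => [w0 _ | no_w]; last first.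
  exists [::] => wt _; rewrite big_nil mulr0 big1 // => g _.
  by rewrite big1 ?mulr0 // => w _; have := no_w w; rewrite !inE.
pose rep (B : {set {ffun T -> L}}) := odflt w0 [pick w in B].
exists [seq (Num.truncn (nf (rep B)), rep B) | B <- enum P] => wt wtJ.
have -> : \sum_(g in G) f g * (\sum_(w | fixes_word g w) wt w)
   = \sum_w wt w * \sum_(g in st w) f g.
  under eq_bigr do rewrite mulr_sumr.
  rewrite (exchange_big_dep xpredT) //=; apply: eq_bigr => w _.
  rewrite mulr_sumr; apply: eq_big => [g|g _]; first by rewrite stE.
  by rewrite mulrC.
have -> : \sum_w wt w * \sum_(g in st w) f g
  = \sum_(w in [set: {ffun T -> L}]) wt w * \sum_(g in st w) f g.
  by apply: eq_bigl => w; rewrite inE.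
rewrite (set_partition_big _ trP) big_map big_enum mulr_sumr /=.
apply: eq_bigr => B /imsetP[w1 _ defO].
have repO : rep B \in B.
  rewrite /rep; case: pickP => //= no; have := no w1.
  by rewrite /= defO orbit_refl.
have {}defB : B = orbit word_action G (rep B).
  by move: (repO); rewrite {2}defO => /orbit_eqP->.
have wO w : w \in B -> exists2 g, g \in G & w = word_act (rep B) g.
  by rewrite {1}defB => /orbitP[g Gg <-]; exists g.
rewrite (eq_bigr (fun=> wt (rep B) * \sum_(g in st (rep B)) f g)); last first.
  by move=> w /wO[g Gg ->]; rewrite wtJ // nfJ.
rewrite sumr_const nfE truncnK // -mulr_natl.
have -> : #|G| = (#|B| * #|st (rep B)|)%N.
  rewrite -(card_orbit_stab word_action G (rep B)); congr (_ * _)%N.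
  by rewrite -defB.
rewrite natrM; ring.
Qed.

End Words.

(** * Sums over the words fixed by a permutation, cycle by cycle *)

Section CycleSums.
Variables (T L : finType) (R : nmodType).
Implicit Types (rs : seq nat) (cs : seq {set T}) (a : {ffun L -> nat}).
Implicit Types (F : {ffun L -> nat} -> R).

Definition add_at (r : nat) (x : L) a : {ffun L -> nat} :=
  [ffun y => a y + r * (x == y)]%N.

(** A word fixed by a permutation amounts to the choice of a letter [x] for each cycle, and a cycle
    of length [r] adds [r] to the content at [x]. Only the lengths [rs] of the cycles matter. *)
Fixpoint cycle_sum rs F : R :=
  if rs is r :: rs' then \sum_x cycle_sum rs' (fun a => F (add_at r x a))
  else F [ffun=> 0%N].

Definition constant_on (c : {set T}) (w : {ffun T -> L}) :=
  [forall i in c, forall j in c, w i == w j].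

Lemma eq_cycle_sum rs F1 F2 : F1 =1 F2 -> cycle_sum rs F1 = cycle_sum rs F2.
Proof.
elim: rs F1 F2 => [|r rs IHrs] F1 F2 eqF /=; first exact: eqF.
by apply: eq_bigr => x _; apply: IHrs => a; apply: eqF.
Qed.

(** The words are pinned to [x0] outside the union of [cs], so that taking a cycle [c] off the list
    leaves a statement of the same form: [h] and [h'] recolour [c] by [x] and by [x0]. *)
Lemma sum_words_constant_on (x0 : L) cs F :
    all (fun c : {set T} => c != set0) cs -> pairwise (fun c d : {set T} => [disjoint c & d]) cs ->
  \sum_(w : {ffun T -> L} | [forall i : T, (i \notin \bigcup_(c <- cs) c) ==> (w i == x0)]
                            && all (constant_on^~ w) cs)
     F [ffun x => \sum_(i in \bigcup_(c <- cs) c) (w i == x)]%N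
  = cycle_sum [seq #|c| | c : {set T} <- cs] F.
Proof.
elim: cs F => [|c cs IHcs] F /=.
  rewrite !big_nil => _ _; rewrite (big_pred1 [ffun=> x0]) => [|w].
    by congr (F _); apply/ffunP=> x; rewrite !ffunE big_set0.
  rewrite andbT; apply/forallP/eqP => [w0 | -> i]; last by rewrite ffunE eqxx implybT.
  by apply/ffunP=> i; have := w0 i; rewrite !ffunE inE => /eqP.
case/andP=> /set0Pn[i0 ci0] ncs /andP[dc dcs].
set A := \bigcup_(d <- cs) d in IHcs *.
have dcA : [disjoint c & A].
  rewrite disjoint_sym; apply/pred0P => i /=; apply/negP => /andP[].
  rewrite /A; elim: (cs) dc => [|d ds IH] /=; first by rewrite big_nil inE.
  case/andP=> dcd dds; rewrite big_cons inE => /orP[di|]; last exact: IH.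
  by move=> ci; have /pred0P/(_ i) := dcd; rewrite /= ci di.
have cA i : i \in c -> i \in A = false.
  by move=> ci; apply/negP => Ai; have /pred0P/(_ i) := dcA; rewrite /= ci Ai.
rewrite (partition_big (fun w : {ffun T -> L} => w i0) xpredT) //=; apply: eq_bigr => x _.
rewrite -(IHcs (fun a => F (add_at #|c| x a))) //.
pose h (w : {ffun T -> L}) : {ffun T -> L} := [ffun i => if i \in c then x else w i].
pose h' (w : {ffun T -> L}) : {ffun T -> L} := [ffun i => if i \in c then x0 else w i].
rewrite (reindex_onto h h') => [|w]; last first.
  case/andP=> /andP[_ /andP[/forall_inP cw _]] /eqP wi0; apply/ffunP=> i; rewrite !ffunE.
  by case ci: (i \in c) => //; have /forall_inP/(_ i0 ci0)/eqP-> := cw i ci.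
apply: eq_big => [w | w _]; last first.
  congr (F _); apply/ffunP=> y; rewrite !ffunE.
  rewrite (eq_bigl (fun i => (i \in A) || (i \in c))); last by move=> i; rewrite big_cons !inE orbC.
  rewrite bigU ?(disjoint_sym A) //=; congr (_ + _)%N.
    by apply: eq_bigr => i Ai; rewrite ffunE; case: ifP => // /cA; rewrite Ai.
  rewrite (eq_bigr (fun=> (x == y) : nat)) => [|i ci]; last by rewrite ffunE ci.
  by rewrite sum_nat_const.
have -> : h w i0 == x by rewrite ffunE ci0.
have -> : constant_on c (h w).
  by apply/forall_inP=> i ci; apply/forall_inP=> j cj; rewrite !ffunE ci cj.
have -> : all (constant_on^~ (h w)) cs = all (constant_on^~ w) cs.
  apply: eq_in_all => d cs_d; have dA i : i \in d -> i \in c = false.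
    move=> di; apply: contraTF di => ci; apply/negP => di; have := cA i ci.
    by rewrite /A (big_rem d) //= inE di.
  by apply: eq_forallb_in => i di; apply: eq_forallb_in => j dj; rewrite !ffunE !dA.
rewrite /= !andbT andbAC; congr (_ && _).
apply/idP/forallP => [/andP[/forallP w1 /eqP hw] i|w1]; last apply/andP.
  apply/implyP=> nAi; case ci: (i \in c); first by rewrite -hw !ffunE ci.
  by have := w1 i; rewrite big_cons inE ci nAi !ffunE ci.
split; last first.
  apply/eqP/ffunP=> i; rewrite !ffunE; case ci: (i \in c) => //; apply/esym/eqP.
  by have := w1 i; rewrite cA.
apply/forallP=> i; rewrite big_cons inE negb_or ffunE.
by case ci: (i \in c) => //=; apply: w1.
Qed.

Lemma porbits_pairwise (g : {perm T}) cs : perm_eq cs (enum (porbits g)) ->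
  [/\ all (fun c : {set T} => c != set0) cs, pairwise (fun c d : {set T} => [disjoint c & d]) cs
    & \bigcup_(c <- cs) (c : {set T}) = [set: T]].
Proof.
move=> cs_g; have csE c : (c \in cs) = (c \in porbits g) by rewrite (perm_mem cs_g) mem_enum.
have ucs : uniq cs by rewrite (perm_uniq cs_g) enum_uniq.
split.
- apply/allP=> c; rewrite csE => /imsetP[x _ ->]; apply/set0Pn; exists x.
  exact: porbit_id.
- rewrite uniq_pairwise in ucs.
  apply: (@sub_in_pairwise _ [pred c | c \in cs] _ _ _ _ _ ucs); last exact/allP.
  move=> c d; rewrite !inE !csE => /imsetP[x _ ->] /imsetP[y _ ->] /=.
  apply: contraR => /pred0Pn[z /= /andP[xz yz]].
  by rewrite -!eq_porbit_mem in xz yz; rewrite -(eqP xz) (eqP yz).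
apply/setP=> x; rewrite inE (perm_big _ cs_g) big_enum /=.
by apply/bigcupP; exists (porbit g x); [apply: imset_f | apply: porbit_id].
Qed.

(** The order of the cycles in [cs] is free: later uses list first the cycles of length divisible by
    some q, or sort them by length. *)
Lemma sum_fixed_words (x0 : L) (g : {perm T}) cs F : perm_eq cs (enum (porbits g)) ->
  \sum_(w : {ffun T -> L} | fixes_word g w) F (content w)
     = cycle_sum [seq #|c| | c : {set T} <- cs] F.
Proof.
move=> cs_g; have [ncs dcs covcs] := porbits_pairwise cs_g.
rewrite -(sum_words_constant_on x0) // covcs; apply: eq_big => [w | w _]; last first.
  by congr (F _); apply/ffunP=> x; rewrite !ffunE; apply: eq_bigl => i; rewrite inE.
have -> : [forall i, (i \notin [set: T]) ==> (w i == x0)] by apply/forallP=> i; rewrite inE.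
rewrite (eq_all_r (perm_mem cs_g)) /=; apply/forallP/allP => [fw c | cw i].
  rewrite mem_enum => /imsetP[i _ ->]; apply/forall_inP => j ij; apply/forall_inP => k ik.
  have fwi l : l \in porbit g i -> w l = w i.
    case/porbitP=> m ->; elim: m => [|m IHm]; first by rewrite expg0 perm1.
    by rewrite expgSr permM (eqP (fw _)).
  by rewrite !fwi.
have /cw/forall_inP/(_ (g i)) : porbit g i \in enum (porbits g) by rewrite mem_enum imset_f.
rewrite -[g i]/((g ^+ 1%N)%g i) mem_porbit => /(_ isT)/forall_inP/(_ i).
by rewrite porbit_id => /(_ isT).
Qed.

End CycleSums.

Lemma cycle_sum_prod (L : finType) (R : comPzSemiRingType) (x : L -> R) (rs : seq nat) :
  cycle_sum rs (fun a : {ffun L -> nat} => \prod_y x y ^+ a y) = \prod_(r <- rs) \sum_y x y ^+ r.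
Proof.
(* The scalar [c] collects the contributions of the letters already chosen, as the induction
   requires. *)
pose F c (a : {ffun L -> nat}) : R := c * \prod_y x y ^+ a y.
have gen c : cycle_sum rs (F c) = c * \prod_(r <- rs) \sum_y x y ^+ r.
  elim: rs c => [|r rs IHrs] c /=.
    by rewrite big_nil /F big1 // => y _; rewrite ffunE.
  rewrite big_cons mulrA mulr_sumr mulr_suml; apply: eq_bigr => y _; rewrite -IHrs.
  apply: eq_cycle_sum => a; rewrite /F -mulrA; congr (c * _).
  rewrite (eq_bigr (fun z => x z ^+ a z * x z ^+ (r * (y == z)))) => [|z _]; last first.
    by rewrite ffunE exprD.
  rewrite big_split mulrC /=; congr (_ * _).
  rewrite (bigD1 y) //= eqxx muln1 big1 ?mulr1 // => z; rewrite eq_sym => /negPf->.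
  by rewrite muln0.
by rewrite -[RHS]mul1r -gen; apply: eq_cycle_sum => a; rewrite /F mul1r.
Qed.

(** * Characters of p-groups of permutations *)

(* The p-adic valuation of (p ^ j)!, which is also (p ^ j - 1) / (p - 1). *)
Definition hook_val (p j : nat) : nat := (\sum_(i < j) p ^ i)%N.

Definition cycle_weight (T : finType) (p : nat) (g : {perm T}) : nat :=
  (\sum_(c in porbits g) hook_val p (logn p #|c|))%N.

Lemma hook_val_split p j k : hook_val p (j + k) = (p ^ k * hook_val p j + hook_val p k)%N.
Proof.
rewrite /hook_val addnC big_split_ord /= addnC big_distrr /=; congr (_ + _)%N.
by apply: eq_bigr => i _; rewrite expnD.
Qed.

Lemma leq_hook_val p j : (0 < p)%N -> (j <= hook_val p j)%N.
Proof.
move=> p_gt0; rewrite /hook_val -[leqLHS]card_ord -sum1_card.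
by apply: leq_sum => i _; rewrite expn_gt0 p_gt0.
Qed.

(* The b_j are Witt coordinates: with beta_j := b_j (-1/p)^(hook_val p j), the ghost components
   sum_(j <= J) p^j beta_j^(p^(J-j)) are 1, 0, 0, ... *)
Lemma ghost_coordinates p : (0 < p)%N -> forall m, exists2 b : nat -> int, b 0%N = 1 &
  forall J, (0 < J <= m)%N ->
   \sum_(j < J.+1) b j ^+ (p ^ (J - j)) * (-1) ^+ hook_val p (J - j)
                   * p%:R ^+ (hook_val p (J - j) - (J - j)) = 0.
Proof.
move=> p_gt0; elim=> [|m [b b0 IHb]]; first by exists (fun=> 1) => // -[|J].
pose v := - \sum_(j < m.+1) b j ^+ (p ^ (m.+1 - j)) * (-1) ^+ hook_val p (m.+1 - j)
                   * p%:R ^+ (hook_val p (m.+1 - j) - (m.+1 - j)).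
exists (fun j => if j == m.+1 then v else b j) => // J /andP[J_gt0].
rewrite leq_eqVlt => /predU1P[-> | ltJm]; last first.
  rewrite -[RHS](IHb J) ?J_gt0 //; apply: eq_bigr => j _.
  by rewrite ltn_eqF // (leq_ltn_trans _ ltJm) // -ltnS.
rewrite big_ord_recr /= eqxx subnn /hook_val big_ord0 expn0 !expr1 !expr0 !mulr1 addrC.
by apply/eqP; rewrite addr_eq0 eq_sym; apply/eqP; congr (- _); apply: eq_bigr => j _; rewrite ltn_eqF.
Qed.

(** By [hook_val_split], multiplying the integral identity by p^J (-1/p)^(hook_val p J) turns it
    term by term into the one at x = -1/p. *)
Lemma ghost_vanish p m (b : nat -> int) J : (0 < p)%N -> (0 < J <= m)%N ->
  (forall J, (0 < J <= m)%N ->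
   \sum_(j < J.+1) b j ^+ (p ^ (J - j)) * (-1) ^+ hook_val p (J - j)
                   * p%:R ^+ (hook_val p (J - j) - (J - j)) = 0) ->
  \sum_(j < J.+1) p%:R ^+ j * ((b j)%:~R * (- p%:R^-1) ^+ hook_val p j) ^+ (p ^ (J - j)) = 0 :> algC.
Proof.
move=> p_gt0 Jm /(_ J Jm)/(congr1 (fun z : int => z%:~R : algC)).
rewrite rmorph0 rmorph_sum /= => E0.
have p0 : p%:R != 0 :> algC by rewrite pnatr_eq0 -lt0n.
rewrite -[RHS](mulr0 (p%:R ^+ J * (- p%:R^-1) ^+ hook_val p J)) -[X in _ = _ * X]E0 mulr_sumr.
apply: eq_bigr => j _; rewrite !rmorphM !rmorphXn /= rmorphN rmorph1 rmorph_nat.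
have leJ : (j <= J)%N by rewrite -ltnS.
have lek := leq_hook_val (J - j) p_gt0.
set k := hook_val p (J - j) in lek *.
have -> : hook_val p J = (p ^ (J - j) * hook_val p j + k)%N by rewrite -hook_val_split subnKC.
rewrite exprMn -exprM [(hook_val p j * _)%N]mulnC exprD.
have subX a c : (c <= a)%N -> p%:R ^+ (a - c) = p%:R ^+ a / p%:R ^+ c :> algC.
  by move=> leca; rewrite -{2}(subnK leca) exprD mulfK ?expf_neq0.
have -> : p%:R ^+ j = p%:R ^+ J / p%:R ^+ (J - j) :> algC.
  by rewrite -subX ?leq_subr // subKn.
rewrite (subX _ _ lek).
have E1 : (- p%:R^-1) ^+ k * ((-1) ^+ k * p%:R ^+ k) = 1 :> algC.
  by rewrite -!exprMn mulrA mulrN1 opprK mulVf ?expr1n.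
by rewrite -[LHS]mulr1 -[X in _ * X = _]E1; ring.
Qed.

(** Discrete Fourier inversion. It transfers integrality from the values of [h] at roots of unity to
    its coefficients, at the cost of the factor [r]. *)
Lemma root_unity_coef (h : {poly algC}) r z k :
  r.-primitive_root z -> (size h <= r)%N -> (k < r)%N ->
  r%:R * h`_k = \sum_(i < r) z^-1 ^+ (i * k) * h.[z ^+ i].
Proof.
move=> prz szh ltkr; have r_gt0 := prim_order_gt0 prz.
under eq_bigr => i _ do rewrite (horner_coef_wide _ szh) mulr_sumr.
rewrite exchange_big (bigD1 (Ordinal ltkr)) //= [X in _ + X]big1 ?addr0 => [|l nlk].
  rewrite (eq_bigr (fun=> h`_k)) ?sumr_const ?card_ord ?mulr_natl // => i _.
  by rewrite mulrCA -exprM -exprMn mulVf ?expr1n ?mulr1 // (prim_root_eq0 prz) -lt0n.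
pose u := z ^+ l / z ^+ k.
have z0 : z != 0 by rewrite (prim_root_eq0 prz) -lt0n.
rewrite (eq_bigr (fun i : 'I_r => h`_l * u ^+ i)) => [|i _]; last first.
  by rewrite /u expr_div_n -!exprM exprVn mulnC [(i * l)%N]mulnC; ring.
have u1 : u != 1.
  apply: contra nlk => /eqP u1; have : z ^+ l == z ^+ k.
    by rewrite -[z ^+ l](divfK (expf_neq0 k z0)) -/u u1 mul1r.
  by rewrite (eq_prim_root_expr prz) !modn_small.
rewrite -mulr_sumr; suff -> : \sum_(i < r) u ^+ i = 0 by rewrite mulr0.
have := subrX1 u r; rewrite {1}/u expr_div_n -!exprM ![(_ * r)%N]mulnC !exprM.
rewrite (prim_expr_order prz) !expr1n divr1 subrr => /esym/eqP; rewrite mulf_eq0 subr_eq0 (negPf u1) /=.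
by move/eqP.
Qed.

Lemma porbit1 (T : finType) (t : T) : porbit 1%g t = [set t].
Proof.
apply/setP=> u; rewrite inE; apply/porbitP/eqP => [[i ->] | ->]; first by rewrite expg1n perm1.
by exists 0%N; rewrite perm1.
Qed.

Lemma porbit_card_pnat (T : finType) p (g : {perm T}) (c : {set T}) :
  p.-elt g -> c \in porbits g -> p.-nat #|c|.
Proof.
by move=> pg /imsetP[x _ ->]; rewrite porbitE; apply: pnat_dvd (dvdn_orbit _ _ _) pg.
Qed.

(** The polynomial A_J: its value at x is the J-th ghost component of the Witt vector with
    coordinates b_j x^(hook_val p j). *)
Definition ghost_poly (p : nat) (b : nat -> int) (J : nat) : {poly algC} :=
  \sum_(j < J.+1) (p%:R ^+ j * (b j)%:~R ^+ (p ^ (J - j)))%:P * 'X^(hook_val p j * p ^ (J - j)).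

Lemma size_ghost_poly p b J : (size (ghost_poly p b J) <= (hook_val p J).+1)%N.
Proof.
apply: leq_trans (size_sum _ _ _) _; apply/bigmax_leqP => j _.
rewrite mul_polyC; apply: leq_trans (size_scale_leq _ _) _; rewrite size_polyXn ltnS.
have leJ : (j <= J)%N by rewrite -ltnS.
have -> : hook_val p J = (p ^ (J - j) * hook_val p j + hook_val p (J - j))%N.
  by rewrite -hook_val_split subnKC.
by rewrite mulnC leq_addr.
Qed.

Lemma horner_ghost_poly p b J (x : algC) :
  (ghost_poly p b J).[x]
   = \sum_(j < J.+1) p%:R ^+ j * ((b j)%:~R * x ^+ hook_val p j) ^+ (p ^ (J - j)).
Proof.
rewrite horner_sum; apply: eq_bigr => j _.
by rewrite hornerM hornerC hornerXn exprMn -exprM mulrA.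
Qed.

(** For each j the letters are all the p^j-th roots of b_j x^(hook_val p j), namely [u j * w j ^+ k]
    for k < p^j. Their power sum of order p^J is the j-th term of the ghost component if j <= J; it
    is 0 if j > J, because [w j ^+ (p ^ J)] is then a nontrivial root of unity. *)
Lemma ghost_letters p b m (x : algC) r : prime p -> (0 < r)%N -> x ^+ r = 1 ->
  exists y : 'I_m.+1 * 'I_(p ^ m) -> algC, (forall z, y z \in Aint) /\
    (forall J, (J <= m)%N -> \sum_z y z ^+ (p ^ J) = (ghost_poly p b J).[x]).
Proof.
move=> p_pr r_gt0 xr; have p_gt0 := prime_gt0 p_pr.
have pX_gt0 j : (0 < p ^ j)%N by rewrite expn_gt0 p_gt0.
pose u j := (p ^ j).-root ((b j)%:~R * x ^+ hook_val p j) : algC.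
have uK j : u j ^+ (p ^ j) = (b j)%:~R * x ^+ hook_val p j by rewrite rootCK.
have prim j : {w : algC | (p ^ j)%N.-primitive_root w} by apply: C_prim_root_exists.
pose w j := sval (prim j).
have wP j : (p ^ j)%N.-primitive_root (w j) := svalP (prim j).
(* The index type is a rectangle, so the places (j, k) with k >= p^j are filled with the letter 0,
   which adds nothing to power sums of positive order. *)
exists (fun z : 'I_m.+1 * 'I_(p ^ m) => if (z.2 < p ^ z.1)%N then u z.1 * w z.1 ^+ z.2 else 0); split=> [z|J leJm].
  case: ifP => // _.
  apply: rpredM; last by apply: rpredX; apply: Aint_prim_root (wP _).
  (* Since x^r = 1, the power of [u j] of order p^j r is the integer b_j^r. *)
  apply: (@root_monic_Aint ('X^(p ^ z.1 * r) - ((b z.1)%:~R ^+ r)%:P)).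
  - rewrite /root !hornerE exprM uK exprMn -exprM [(hook_val _ _ * _)%N]mulnC exprM.
    by rewrite xr expr1n mulr1 subrr.
  - by rewrite monicXnsubC // muln_gt0 pX_gt0.
  apply/polyOverP=> i; rewrite coefB coefC coefXn rpredB ?rpred_nat //.
  by case: ifP => _; rewrite ?rpred0 ?rpredX ?intr_int.
rewrite (horner_ghost_poly p b J x).
rewrite -(pair_bigA _ (fun (j : 'I_m.+1) (k : 'I_(p ^ m)) =>
  (if (k < p ^ j)%N then u j * w j ^+ k else 0) ^+ (p ^ J))) /=.
have E (j : 'I_m.+1) : \sum_(k < p ^ m) (if (k < p ^ j)%N then u j * w j ^+ k else 0) ^+ (p ^ J)
    = u j ^+ (p ^ J) * \sum_(k < p ^ j) (w j ^+ (p ^ J)) ^+ k.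
  rewrite (bigID (fun k : 'I__ => (k < p ^ j)%N)) /= [X in _ + X]big1 ?addr0; last first.
    by move=> k /negPf->; rewrite expr0n eqn0Ngt pX_gt0.
  rewrite mulr_sumr (big_ord_widen (p ^ m) (fun k => u j ^+ (p ^ J) * (w j ^+ (p ^ J)) ^+ k)).
    by apply: eq_bigr => k ->; rewrite exprMn -!exprM [(k * _)%N]mulnC.
  by rewrite leq_exp2l ?prime_gt1 // -ltnS.
rewrite (eq_bigr _ (fun j _ => E j)) (bigID (fun j : 'I__ => (j < J.+1)%N)) /=.
rewrite [X in _ + X]big1 ?addr0 => [|j]; last first.
  rewrite -leqNgt => ltJj; suff -> : \sum_(k < p ^ j) (w j ^+ (p ^ J)) ^+ k = 0 by rewrite mulr0.
  have w1 : w j ^+ (p ^ J) != 1.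
    rewrite -(prim_order_dvd (wP j)); apply/negP => /dvdn_leq; rewrite pX_gt0 => /(_ isT).
    by rewrite leqNgt ltn_exp2l ?prime_gt1 // ltJj.
  apply/eqP; rewrite -(inj_eq (mulfI (_ : w j ^+ (p ^ J) - 1 != 0))) ?subr_eq0 //.
  by rewrite mulr0 -subrX1 -exprM mulnC exprM (prim_expr_order (wP j)) expr1n subrr.
rewrite (big_ord_widen m.+1 (fun j => p%:R ^+ j * ((b j)%:~R * x ^+ hook_val p j) ^+ (p ^ (J - j)))) //.
apply: eq_bigr => j ltjJ; have leJ : (j <= J)%N by rewrite -ltnS.
rewrite -uK -exprM -expnD subnKC // mulrC; congr (_ * _).
rewrite (eq_bigr (fun=> 1)) ?sumr_const ?card_ord ?natrX // => k _.
by rewrite -{1}(subnKC leJ) expnD exprM (prim_expr_order (wP j)) !expr1n.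
Qed.

Lemma dvdn_pgroup_char1 (T : finType) (p D : nat) (P : {group {perm T}}) (f : 'CF(P)) :
    prime p -> p.-group P -> f \is a character ->
    (forall g, g \in P -> f g != 0 -> (cycle_weight p g <= D)%N) ->
  (#|P| %| p ^ D * chardeg f)%N.
Proof.
move=> p_pr pP Nf fD; have p_gt0 := prime_gt0 p_pr.
have p0 : p%:R != 0 :> algC by rewrite pnatr_eq0 -lt0n.
have P0 : #|P|%:R != 0 :> algC by rewrite pnatr_eq0 -lt0n cardG_gt0.
pose m := #|T|; have [b b0 bE] := ghost_coordinates p_gt0 m.
have logm (c : {set T}) : (logn p #|c| <= m)%N.
  apply: leq_trans (max_card (mem c)); case: (posnP #|c|) => [->|c_gt0]; first by rewrite logn0.
  by rewrite ltnW // ltn_logl.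
have cardP g (c : {set T}) : g \in P -> c \in porbits g -> #|c| = (p ^ logn p #|c|)%N.
  by move=> Pg gc; rewrite -p_part part_pnat_id // (porbit_card_pnat (mem_p_elt pP Pg)).
pose A := ghost_poly p b.
pose h := #|P|%:R^-1 *: \sum_(g in P) f g *: \prod_(c in porbits g) A (logn p #|c|).
have szh : (size h <= D.+1)%N.
  apply: leq_trans (size_scale_leq _ _) _; apply: leq_trans (size_sum _ _ _) _.
  apply/bigmax_leqP => g Pg; have [-> | nzf] := eqVneq (f g) 0; first by rewrite scale0r size_poly0.
  apply: leq_trans (size_scale_leq _ _) _.
  apply: leq_trans (_ : _ <= (cycle_weight p g).+1)%N _; last by rewrite ltnS fD.
  apply: leq_trans (size_prod_leq _ _) _; rewrite leq_subLR addnS ltnS.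
  rewrite -sum1_card -big_split /=; apply: leq_sum => c _.
  by rewrite add1n size_ghost_poly.
(* This [r] exceeds the degree of [h], so the values at the r-th roots of unity determine [h]; it is
   prime to p, so the factor [r] lost in the interpolation does not affect divisibility by the
   p-power [#|P|]. *)
pose r := (p * D).+1.
have hAint x : x ^+ r = 1 -> h.[x] \in Aint.
  move=> xr; have [y [Ay yE]] := ghost_letters b m p_pr (ltn0Sn _) xr.
  (* The product of power sums over the cycles of g is a sum over the words fixed by g of a weight
     that depends only on the content, so [weighted_words] supplies the factor [#|P|] to be
     cancelled. *)
  have [s sE] := weighted_words ('I_m.+1 * 'I_(p ^ m))%type Nf.
  have {sE} := sE (fun w => \prod_z y z ^+ content w z).
  have -> : h.[x] = #|P|%:R^-1 * \sum_(g in P) f g *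
       \sum_(w | fixes_word g w) \prod_z y z ^+ content w z.
    rewrite hornerZ horner_sum; congr (_ * _); apply: eq_bigr => g Pg.
    rewrite hornerZ; congr (_ * _).
    have z0 : 'I_m.+1 * 'I_(p ^ m).
      by split; [exact: ord0 | apply: Ordinal (_ : 0 < _)%N; rewrite expn_gt0 p_gt0].
    rewrite (sum_fixed_words z0 (fun a => \prod_z y z ^+ a z) (perm_refl _)).
    rewrite cycle_sum_prod horner_prod big_map big_enum /=.
    by apply: eq_bigr => c gc; rewrite -yE // -(cardP g).
  move=> -> => [|w g _]; last by apply: eq_bigr => z _; rewrite content_act.
  rewrite mulKf //; apply: rpred_sum => z _; apply: rpredM; first by rewrite rpred_nat.
  by apply: rpred_prod => t _; apply: rpredX.
(* A permutation g != 1 in P has a cycle of length p^J with J > 0, and A_J vanishes at -1/p; only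
   the term of g = 1 survives. *)
have h0 : h.[- p%:R^-1] = f 1%g / #|P|%:R.
  rewrite hornerZ horner_sum mulrC; congr (_ / _).
  rewrite (bigD1 1%g) //= hornerZ horner_prod big1 ?mulr1 => [|c /imsetP[t _ ->]]; last first.
    by rewrite porbit1 cards1 logn1 horner_ghost_poly big_ord_recl big_ord0 /hook_val big_ord0 b0 mulr1z !expr0 mulr1 expr1n mulr1 addr0.
  rewrite big1 ?addr0 // => g /andP[Pg g1]; rewrite hornerZ horner_prod.
  have [t gt] : exists t, g t != t.
    by apply/existsP; apply: contraNT g1; rewrite negb_exists => /forallP fg;
       apply/eqP/permP=> t; rewrite perm1; apply/eqP; have := fg t; rewrite negbK.
  rewrite (bigD1 (porbit g t)) ?imset_f //= horner_ghost_poly (ghost_vanish p_gt0 _ bE) ?mul0r ?mulr0 //.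
  rewrite logm andbT lt0n; apply: contra gt => /eqP l0.
  have := cardP g (porbit g t) Pg; rewrite imset_f // l0 => /(_ isT)/eqP.
  rewrite expn0 => /cards1P[u gtu].
  have := mem_porbit g 1 t; rewrite gtu expg1 => /set1P->.
  by have := porbit_id g t; rewrite gtu => /set1P->.
have [z prz] := C_prim_root_exists (ltn0Sn (p * D)).
have szr : (size h <= r)%N by rewrite (leq_trans szh) // ltnS leq_pmull.
have coefA k : r%:R * h`_k \in Aint.
  have [ltkr | lerk] := ltnP k r; last by rewrite nth_default ?mulr0 // (leq_trans szr).
  rewrite (root_unity_coef prz szr ltkr); apply: rpred_sum => i _; apply: rpredM.
    apply: rpredX; apply: (@Aint_unity_root r) => //; apply/unity_rootP.
    by rewrite exprVn (prim_expr_order prz) invr1.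
  by apply: hAint; rewrite -exprM mulnC exprM (prim_expr_order prz) expr1n.
have: r%:R * p%:R ^+ D * (f 1%g / #|P|%:R) \in Aint.
  rewrite -h0 (horner_coef_wide _ szh) mulr_sumr; apply: rpred_sum => k _.
  have leD : (k <= D)%N by rewrite -ltnS.
  (* The factor p^D clears the denominator of (-1/p)^k, as k <= D. *)
  have -> : r%:R * p%:R ^+ D * (h`_k * (- p%:R^-1) ^+ k) = r%:R * h`_k * ((-1) ^+ k * p%:R ^+ (D - k)).
    rewrite -{1}(subnK leD) exprD.
    have E1 : p%:R ^+ k * (- p%:R^-1) ^+ k = (-1) ^+ k :> algC by rewrite -exprMn mulrN mulfV.
    rewrite -E1; ring.
  by rewrite rpredM ?coefA // rpredM ?rpredX ?rpredN ?rpred1 ?rpred_nat.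
rewrite -(chardegK Nf) => hAi.
have {hAi} hint : (r%:R * p%:R ^+ D * ((chardeg f)%:R / #|P|%:R) : algC) \is a Num.int.
  have Crat_nat k : k%:R \in Crat by apply: rpred_nat.
  apply: (Cint_rat_Aint _ hAi); apply: rpredM; first by apply: rpredM => //; apply: rpredX.
  by apply: rpredM => //; rewrite rpredV.
suff : (#|P| %| r * (p ^ D * chardeg f))%N.
  have co_r : coprime #|P| r.
    by rewrite (pnat_coprime pP) // p'natE // /r -addn1 dvdn_addr ?dvdn_mulr // dvdn1 neq_ltn prime_gt1 ?orbT.
  by rewrite Gauss_dvdr.
rewrite -dvdC_nat; apply/dvdCP; exists (r%:R * p%:R ^+ D * ((chardeg f)%:R / #|P|%:R)) => //.
have E : (r * (p ^ D * chardeg f))%:R = r%:R * p%:R ^+ D * ((chardeg f)%:R / #|P|%:R) * #|P|%:R :> algC.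
  by rewrite !natrM natrX !mulrA mulfVK.
exact: E.
Qed.

(** * Irreducible characters of symmetric groups *)

Section ContentOrbits.
Variables (n : nat) (L : finType).
Implicit Types (w : {ffun 'I_n -> L}).

Lemma content_count w x : content w x = count_mem x [seq w i | i : 'I_n].
Proof.
rewrite ffunE /image_mem count_map -sum1_count big_enum_cond /= [RHS]big_mkcond.
by apply: eq_bigr => i _; case: eqP.
Qed.

Lemma eq_content w w' : content w = content w' -> exists g, w' = word_act w g.
Proof.
move=> eqc; have : perm_eq [tuple w' i | i < n] [tuple w i | i < n].
  apply/allP=> x _ /=; apply/eqP.
  by rewrite !(eq_count (_ : _ =1 pred1 x)) // -!content_count eqc.
case/tuple_permP=> p E; exists p^-1%g; apply/ffunP=> i; rewrite ffunE invgK.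
by have := congr1 (fun t => tnth t i) (val_inj E); rewrite !tnth_mktuple.
Qed.

Lemma sum_content w : (\sum_x content w x = n)%N.
Proof.
under eq_bigr do rewrite ffunE.
rewrite exchange_big -[RHS]card_ord -sum1_card; apply: eq_bigr => i _.
by rewrite (bigD1 (w i)) //= eqxx big1 // => x; rewrite eq_sym => /negPf->.
Qed.

Lemma content_surj (a : {ffun L -> nat}) : (\sum_x a x = n)%N -> exists w, content w = a.
Proof.
move=> sa; pose s := flatten [seq nseq (a x) x | x <- enum L].
have szs : size s = n.
  rewrite size_flatten /shape -map_comp sumnE big_map big_enum /= -sa.
  by apply: eq_bigr => x _; rewrite /= size_nseq.
exists [ffun i => tnth (tcast szs (in_tuple s)) i]; apply/ffunP=> x.
rewrite content_count.
have -> : [seq [ffun i => tnth (tcast szs (in_tuple s)) i] i | i : 'I_n] = s.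
  transitivity [seq tnth (tcast szs (in_tuple s)) i | i <- enum 'I_n].
    by apply: eq_map => i; rewrite ffunE.
  by rewrite map_tnth_enum val_tcast.
rewrite count_flatten -map_comp sumnE big_map big_enum /= (bigD1 x) //= count_nseq /= eqxx mul1n.
by rewrite big1 ?addn0 // => y /negPf yx; rewrite count_nseq /= yx.
Qed.

(** The words of a given content form a single orbit, and an orbit times the order of a stabiliser
    is n!. The bound [M] only serves to make the contents range over a finite type. *)
Lemma sum_perm_words (M : nat) (R : pzSemiRingType) (phi : {ffun L -> nat} -> R) : (n < M)%N ->
  \sum_(g : {perm 'I_n}) \sum_(w | fixes_word g w) phi (content w)
    = n`!%:R * \sum_(a : {ffun L -> 'I_M} | (\sum_x a x == n)%N) phi [ffun x => val (a x)].
Proof.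
case: M => // M leM; pose ca w : {ffun L -> 'I_M.+1} := [ffun x => inord (content w x)].
have caK w : [ffun x => val (ca w x)] = content w.
  apply/ffunP=> x; rewrite ffunE [ca w x]ffunE /= inordK // (leq_ltn_trans _ leM) //.
  by rewrite -{2}(sum_content w) (bigD1 x) //= leq_addr.
rewrite (exchange_big_dep xpredT) //= mulr_sumr.
rewrite (partition_big ca (fun a => \sum_x a x == n)%N) /= => [|w _]; last first.
  rewrite -[X in _ == X](sum_content w); apply/eqP; apply: eq_bigr => x _.
  by rewrite -(caK w) [in RHS]ffunE.
apply: eq_bigr => a /eqP sa.
have [w0 w0a] : exists w, content w = [ffun x => val (a x)].
  by apply: content_surj; rewrite -[RHS]sa; apply: eq_bigr => x _; rewrite ffunE.
have caE w : (ca w == a) = (content w == content w0).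
  apply/eqP/eqP => [E | E]; first by rewrite w0a -E caK.
  by apply/ffunP=> x; apply/val_inj; move/ffunP/(_ x): (caK w); rewrite E w0a !ffunE.
pose G := [set: {perm 'I_n}]%G.
have orbE w : (ca w == a) = (w \in orbit (word_action 'I_n L) G w0).
  rewrite caE; apply/eqP/orbitP => [/esym/eq_content[g ->] | [g _ <-]]; last by rewrite content_act.
  by exists g; rewrite ?inE.
rewrite (eq_bigl _ _ orbE).
have E w : w \in orbit (word_action 'I_n L) G w0 ->
   \sum_(g | fixes_word g w) phi (content w)
    = #|'C_G[w0 | word_action 'I_n L]|%:R * phi [ffun x => val (a x)].
  move=> Ow; have := Ow; rewrite -orbE caE => /eqP->; rewrite w0a sumr_const mulr_natl.
  congr (_ *+ _); have := card_orbit_stab (word_action 'I_n L) G w.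
  rewrite (orbit_eqP Ow) -(card_orbit_stab (word_action 'I_n L) G w0).
  move/eqP; rewrite eqn_pmul2l; last by apply/card_gt0P; exists w0; apply: orbit_refl.
  move/eqP <-; apply: eq_card => g; apply/esym.
  transitivity (fixes_word g w); last by [].
  by rewrite inE in_setT fixes_wordE; apply/astab1P/eqP.
by rewrite (eq_bigr _ E) sumr_const -[LHS]mulr_natl mulrA -natrM card_orbit_stab cardsT card_Sn.
Qed.

End ContentOrbits.

(** Expands a factor x as a sum over the positive r that can be subtracted from x, in a range
    independent of x. *)
Lemma sum_pos_le (M x : nat) : (x < M)%N -> (\sum_(r < M | (0 < r)%N && (r <= x)%N) 1 = x)%N.
Proof.
move=> ltxM; transitivity (\sum_(r < x.+1 | (0 < r)%N) 1)%N.
  by rewrite (big_ord_widen_cond M (fun r => 0 < r)%N (fun=> 1%N)).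
by rewrite big_mkcond big_ord_recl /= add0n sum1_card card_ord.
Qed.

Lemma bin2_double n : ('C(n, 2) * 2 = n * n.-1)%N.
Proof.
rewrite bin2 muln2 halfK oddM; case: n => //= n.
by case: (odd n); rewrite /= subn0.
Qed.

(** * Antisymmetrised indicators *)

Section BetaSets.
Variable N : nat.
Implicit Types (l m a : {ffun 'I_N -> nat}) (i j k : 'I_N) (s : 'S_N).

Definition sub_at (r : nat) i l : {ffun 'I_N -> nat} := [ffun k => l k - r * (i == k)]%N.

(** The signed indicator of [l] being a rearrangement of [m]; it vanishes as soon as [l] or [m]
    repeats an entry. *)
Definition alt_delta l m : algC := \det (\matrix_(i, j) (l i == m j)%:R).

(* The sign of l - a as an arrangement of (0, ..., N - 1), and 0 when it is none or
   when a <= l fails. *)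
Definition alt_eps l a : algC := \det (\matrix_(i, j) (l i == a i + j)%N%:R).

Lemma det_bool_mx (b : 'I_N -> 'I_N -> bool) :
  \det (\matrix_(i, j) (b i j)%:R) = \sum_(s : 'S_N) (-1) ^+ s * [forall i, b i (s i)]%:R :> algC.
Proof.
apply: eq_bigr => s _; congr (_ * _).
under eq_bigr => i _ do rewrite mxE.
rewrite -natr_prod; congr (_%:R); case: forallP => [all_b | not_all].
  by rewrite big1 // => i _; rewrite all_b.
apply/eqP; rewrite prod_nat_seq_eq0; apply/hasP; case: (pickP (fun i => ~~ b i (s i))).
  by move=> i ni; exists i; rewrite ?mem_index_enum //= (negPf ni).
by move=> all_b; case: not_all => i; have /negbFE := all_b i.
Qed.

Lemma alt_deltaE l m :
  alt_delta l m = \sum_(s : 'S_N) (-1) ^+ s * [forall i, l i == m (s i)]%:R.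
Proof. exact: det_bool_mx. Qed.

Lemma alt_epsE l a :
  alt_eps l a = \sum_(s : 'S_N) (-1) ^+ s * [forall i, l i == a i + s i]%N%:R.
Proof. exact: det_bool_mx. Qed.

Definition near_match (i k : 'I_N) (l m : {ffun 'I_N -> nat}) (s : 'S_N) : bool :=
  (l i + l k == m (s i) + m (s k))%N &&
  [forall a, (a != i) && (a != k) ==> (l a == m (s a))].

Lemma match_sub_diag l m s i r : (r <= l i)%N ->
  (r <= m (s i))%N && [forall a, sub_at r i l a == sub_at r (s i) m (s a)]
    = [forall a, l a == m (s a)].
Proof.
move=> ler; apply/andP/forallP => [[lerm /forallP eq_lm] a | eq_lm].
  have := eq_lm a; rewrite !ffunE (inj_eq perm_inj); case: (i =P a) => [<-|_].
    by rewrite !muln1 eqn_sub2rE.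
  by rewrite !muln0 !subn0.
split; first by rewrite -(eqP (eq_lm i)).
by apply/forallP=> a; rewrite !ffunE (inj_eq perm_inj) (eqP (eq_lm a)).
Qed.

(** For k != i the value of r is forced by the place i, so at most one r contributes; what is left
    is a condition on [l i + l k], symmetric in i and k. *)
Lemma match_sub_offdiag l m s i k r : i != k -> (0 < r)%N ->
  [&& r <= l i, r <= m (s k) & [forall a, sub_at r i l a == sub_at r (s k) m (s a)]]%N
    = (r == l i - m (s i))%N && near_match i k l m s && (m (s i) < l i)%N.
Proof.
move=> nik r_gt0; have nki : k != i by rewrite eq_sym.
apply/and3P/andP => [[ler lerm /forallP eq_lm] | [/andP[/eqP -> /andP[/eqP eqs /forallP eq_lm]] ltl]].
  have := eq_lm i; have := eq_lm k; rewrite !ffunE !(inj_eq perm_inj) !eqxx (negPf nik) (negPf nki).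
  rewrite !muln0 !muln1 !subn0 => /eqP Ek /eqP Ei.
  split; last by lia.
  apply/andP; split; first by lia.
  apply/andP; split; first by lia.
  apply/forallP=> a; apply/implyP=> /andP[nai nak]; have := eq_lm a.
  by rewrite !ffunE !(inj_eq perm_inj) ![_ == a]eq_sym (negPf nai) (negPf nak) !muln0 !subn0.
split; [lia | lia |].
apply/forallP=> a; rewrite !ffunE !(inj_eq perm_inj).
have [<- | nia] := eqVneq i a; first by rewrite (negPf nki) muln1 muln0; lia.
have [<- | nka] := eqVneq k a; first by rewrite muln1 muln0; lia.
by rewrite !muln0 !subn0; have := eq_lm a; rewrite ![a == _]eq_sym nia nka.
Qed.

(** Composing s with the transposition (i k) preserves the condition and reverses the sign. *)
Lemma sum_near_match l m i k : i != k ->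
  \sum_(s : 'S_N) (-1) ^+ s * (near_match i k l m s)%:R = 0 :> algC.
Proof.
move=> nik; set Z := LHS; suff ZN : Z = - Z by apply/eqP; rewrite -eqNr -ZN.
rewrite {1}/Z (reindex_inj (mulgI (tperm i k))) /Z -sumrN; apply: eq_bigr => s _.
rewrite odd_permM odd_tperm nik signr_addb expr1 mulN1r mulNr; congr (- (_ * _%:R)).
rewrite /near_match !permM tpermL tpermR addnC [(m _ + _)%N]addnC [(l k + _)%N]addnC; congr (nat_of_bool (_ && _)).
apply: eq_forallb => a; case: eqP => //= /eqP nai; case: eqP => //= /eqP nak.
by rewrite permM tpermD // eq_sym.
Qed.

(* Leibniz terms with k = i give the factor sum_i l i; for k != i the terms of s
   and of s composed with the transposition (i k) combine to - alt_delta l m. *)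
Lemma sum_alt_delta_sub (M : nat) l m : (forall i, l i < M)%N ->
  \sum_i \sum_j \sum_(r < M | (0 < r)%N && (r <= l i)%N && (r <= m j)%N)
     alt_delta (sub_at r i l) (sub_at r j m)
  = ((\sum_i l i)%:R - 'C(N, 2)%:R) * alt_delta l m.
Proof.
move=> ltM.
pose D s := [forall a, l a == m (s a)].
pose T s i k := near_match i k l m s && (m (s i) < l i)%N.
have -> : \sum_i \sum_j \sum_(r < M | (0 < r)%N && (r <= l i)%N && (r <= m j)%N)
     alt_delta (sub_at r i l) (sub_at r j m)
   = \sum_(s : 'S_N) (-1) ^+ s * (\sum_i ((l i * D s)%:R + \sum_(k | k != i) (T s i k)%:R)).
  under eq_bigr => i _ do under eq_bigr => j _ do under eq_bigr => r _ do rewrite alt_deltaE.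
  under eq_bigr => i _ do under eq_bigr => j _ do rewrite exchange_big /=.
  under eq_bigr => i _ do rewrite exchange_big /=.
  rewrite exchange_big /=; apply: eq_bigr => s _; rewrite mulr_sumr; apply: eq_bigr => i _.
  rewrite (reindex_inj (@perm_inj _ s)) (bigD1 i) //= mulrDr; congr (_ + _).
    rewrite -mulr_sumr; congr (_ * _).
    rewrite -natr_sum; congr _%:R; rewrite -{2}(sum_pos_le (ltM i)) big_distrl /=.
    rewrite big_mkcond [RHS]big_mkcond; apply: eq_bigr => r _.
    case r_gt0: (0 < r)%N => //=; case ler: (r <= l i)%N => //=.
    by rewrite mul1n /D -(match_sub_diag m s ler); case: (r <= _)%N.
  rewrite mulr_sumr; apply: eq_bigr => k nki; rewrite -mulr_sumr; congr (_ * _).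
  rewrite -natr_sum; congr _%:R; rewrite eq_sym in nki.
  have E (r : 'I_M) : (0 < r)%N -> ((r <= l i)%N && (r <= m (s k))%N &&
      [forall a, sub_at r i l a == sub_at r (s k) m (s a)]) = (r == l i - m (s i) :> nat)%N && T s i k.
    by move=> r_gt0; rewrite /T andbA -match_sub_offdiag // andbA.
  case Tsik : (T s i k); last first.
    rewrite big1 // => r /andP[/andP[r_gt0 H1] H2]; have := E r r_gt0.
    by rewrite H1 H2 Tsik andbF /= => ->.
  have ltl : (m (s i) < l i)%N by case/andP: Tsik.
  have ltrM : (l i - m (s i) < M)%N by apply: leq_ltn_trans (leq_subr _ _) (ltM i).
  have r_gt0 : (0 < l i - m (s i))%N by rewrite subn_gt0.
  have := E (Ordinal ltrM); rewrite /= r_gt0 eqxx Tsik => /(_ isT)/andP[H1 H2].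
  rewrite (bigD1 (Ordinal ltrM)) /= ?r_gt0 ?H1 // H2 big1 ?addn0 // => r /andP[/andP[r_gt0' H3] nr].
  case/andP: r_gt0' => r_gt0' H4; have := E r r_gt0'; rewrite Tsik andbT H3 H4.
  by move: nr; rewrite -val_eqE /= => /negPf-> ->.
transitivity (\sum_(s : 'S_N) ((\sum_i l i)%:R * ((-1) ^+ s * (D s)%:R)
    + (-1) ^+ s * \sum_i \sum_(k | k != i) (T s i k)%:R) : algC).
  apply: eq_bigr => s _; rewrite big_split /= mulrDr; congr (_ + _).
  by rewrite [RHS]mulrCA -natrM -natr_sum; congr (_ * _%:R); rewrite big_distrl.
rewrite big_split /= -mulr_sumr -alt_deltaE mulrBl; congr (_ + _).
(* Given a near match, [T s i k], [T s k i] and [D s] correspond to m (s i) being smaller than,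
   greater than or equal to l i. Hence [T s i k + T s k i] is the near match minus [D s], and the
   near matches cancel over s. Counting ordered pairs doubles the sum. *)
have sumT : \sum_(s : 'S_N) (-1) ^+ s * \sum_i \sum_(k | k != i) ((T s i k)%:R + (T s k i)%:R)
    = - ((N * N.-1)%:R * alt_delta l m).
  under eq_bigr => s _ do rewrite mulr_sumr.
  rewrite exchange_big /= (eq_bigr (fun=> - (N.-1%:R * alt_delta l m))) => [|i _].
    by rewrite sumr_const card_ord -[LHS]mulr_natl mulrN mulrA -natrM.
  under eq_bigr => s _ do rewrite mulr_sumr.
  rewrite exchange_big /= (eq_bigr (fun=> - alt_delta l m)) => [|k nki].
    rewrite sumr_const -[LHS]mulr_natl mulrN; congr (- (_%:R * _)).
    by have := cardC1 i; rewrite card_ord.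
  rewrite eq_sym in nki; rewrite -[RHS]add0r -[X in _ = X + _](sum_near_match l m nki) alt_deltaE -sumrN -big_split /=.
  apply: eq_bigr => s _; rewrite -mulrBr; congr (_ * _).
  have -> : (T s k i) = near_match i k l m s && (l i < m (s i))%N.
    rewrite /T /near_match [(l k + _)%N]addnC [(m (s k) + _)%N]addnC.
    under eq_forallb => a do rewrite andbC.
    by case: eqP => //= E; case: forallP => //= _; lia.
  rewrite /T; have -> : [forall a, l a == m (s a)] = near_match i k l m s && (l i == m (s i)).
    apply/forallP/andP => [eq_lm | [/andP[/eqP E /forallP nm] /eqP Ei] a].
      split=> //; rewrite /near_match (eqP (eq_lm i)) (eqP (eq_lm k)) eqxx /=.
      by apply/forallP=> a; rewrite eq_lm implybT.
    have [-> | nai] := eqVneq a i; first exact/eqP.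
    have [-> | nak] := eqVneq a k; first by apply/eqP; lia.
    by have := nm a; rewrite nai nak.
  by case: near_match => /=; rewrite ?addr0 ?subr0 //; case: ltngtP; rewrite /= ?addr0 ?add0r ?subr0 ?subrr.
apply: (mulIf (_ : 2%:R != 0 :> algC)); first by rewrite pnatr_eq0.
transitivity (- ((N * N.-1)%:R * alt_delta l m)); last first.
  rewrite mulNr mulrAC -natrM; congr (- (_%:R * _)).
  exact/esym/bin2_double.
rewrite -sumT mulr_natr mulr2n -big_split; apply: eq_bigr => s _ /=.
rewrite -mulrDr; congr (_ * _).
under [RHS]eq_bigr => i _ do rewrite big_split /=.
rewrite big_split /=; congr (_ + _).
under [LHS]eq_bigr => i _ do rewrite big_mkcond /=.
under [RHS]eq_bigr => i _ do rewrite big_mkcond /=.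
by rewrite exchange_big /=; apply: eq_bigr => i _; apply: eq_bigr => k _; rewrite eq_sym.
Qed.

End BetaSets.

(** * Pairs of congruent entries in a beta-set *)

Section Ranks.
Variable N : nat.
Implicit Types (l m : {ffun 'I_N -> nat}) (i j k : 'I_N).

Definition residue_rank (q : nat) l i : nat := #|[set j | (l j < l i)%N && (l j == l i %[mod q])%N]|.

(** The entries counted share the residue of [l i], so their quotients by q are distinct and smaller
    than that of [l i]. *)
Lemma residue_rank_le q l i : (0 < q)%N -> injective l -> (residue_rank q l i <= l i %/ q)%N.
Proof.
move=> q_gt0 injl; rewrite /residue_rank cardE -[leqRHS](size_iota 0) -(size_map (fun j => l j %/ q)%N).
apply: uniq_leq_size => [|x /mapP[j]].
  rewrite map_inj_in_uniq ?enum_uniq // => j k; rewrite !mem_enum !inE => /andP[_ /eqP jr] /andP[_ /eqP kr] E.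
  by apply: injl; rewrite (divn_eq (l j) q) E jr -kr -divn_eq.
rewrite mem_enum inE => /andP[ltji /eqP jr] ->; rewrite mem_iota add0n /=.
by move: ltji; rewrite {1}(divn_eq (l j) q) {1}(divn_eq (l i) q) jr ltn_add2r ltn_pmul2r.
Qed.

(** The sum of the ranks counts the unordered pairs of congruent entries; so it depends on the
    residues only, which makes it invariant under the removal of multiples of q. *)
Lemma sum_residue_rank q l : injective l ->
  ((\sum_i residue_rank q l i) * 2 = \sum_i \sum_(j | j != i) (l i == l j %[mod q]))%N.
Proof.
move=> injl; rewrite muln2 -addnn.
have E i : residue_rank q l i = (\sum_(j | j != i) ((l j < l i) && (l j == l i %[mod q])))%N.
  rewrite /residue_rank -sum1_card big_mkcond [RHS]big_mkcond; apply: eq_bigr => j _.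
  by rewrite inE; case: (eqVneq j i) => [->|]; rewrite ?ltnn //=; case: (_ && _).
under eq_bigr do rewrite E.
have E2 : (\sum_i \sum_(j | j != i) ((l j < l i) && (l j == l i %[mod q]))
   = \sum_i \sum_(j | j != i) ((l i < l j) && (l i == l j %[mod q])))%N.
  under eq_bigr do rewrite big_mkcond.
  under [RHS]eq_bigr do rewrite big_mkcond.
  by rewrite exchange_big; apply: eq_bigr => i _; apply: eq_bigr => j _; rewrite eq_sym.
rewrite {1}E2 -big_split /=; apply: eq_bigr => i _.
rewrite -big_split /=; apply: eq_bigr => j nji.
have : l j != l i by rewrite (inj_eq injl).
by rewrite [(l j == l i %[mod q])%N]eq_sym; case: ltngtP => //= _ _; case: eqP.
Qed.

Lemma sum_residue_rank1 l : injective l -> (\sum_i residue_rank 1 l i = 'C(N, 2))%N.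
Proof.
move=> injl; apply/eqP; rewrite -(eqn_pmul2r (_ : 0 < 2)%N) // bin2_double sum_residue_rank //.
rewrite (eq_bigr (fun=> N.-1)) ?sum_nat_const ?card_ord // => i _.
rewrite (eq_bigr (fun=> 1%N)) ?sum1_card => [|j _]; last by rewrite !modn1.
by have := cardC1 i; rewrite card_ord.
Qed.

Lemma beta_sum_ge l : injective l -> ('C(N, 2) <= \sum_i l i)%N.
Proof.
move=> injl; rewrite -(sum_residue_rank1 injl); apply: leq_sum => i _.
by rewrite -[leqRHS]divn1 residue_rank_le.
Qed.

(** In the case of equality each entry equals its rank among all the entries. *)
Lemma beta_sum_eq l i : injective l -> (\sum_i l i = 'C(N, 2))%N -> (l i < N)%N.
Proof.
move=> injl sl; have : (l i = residue_rank 1 l i)%N.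
  have le_rk k : (residue_rank 1 l k <= l k)%N by rewrite -[leqRHS]divn1 residue_rank_le.
  apply/eqP; rewrite eqn_leq le_rk andbT leqNgt; apply/negP => lt_rk.
  have := sum_residue_rank1 injl; rewrite -sl (bigD1 i) //= [RHS](bigD1 i) //= => E.
  have : (\sum_(k | k != i) residue_rank 1 l k <= \sum_(k | k != i) l k)%N by apply: leq_sum.
  by apply/negP; rewrite -ltnNge -(ltn_add2l (l i)) -E ltn_add2r.
move->; rewrite /residue_rank -[ltnRHS]card_ord; apply/proper_card/properP; split; first exact/subsetP.
by exists i; rewrite ?inE ?ltnn.
Qed.

End Ranks.

(** * Cauchy's determinant *)

Section CauchySum.
Variable N : nat.
Implicit Types (l m a : {ffun 'I_N -> nat}) (i j k : 'I_N) (s : 'S_N).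

Lemma alt_delta_inj l m : alt_delta l m != 0 -> injective l.
Proof.
move=> nz i k elik; apply/eqP; apply: contraNT nz => nik; apply/eqP.
by apply: (determinant_alternate nik) => j; rewrite !mxE elik.
Qed.

Lemma alt_eps_neq0 l a : alt_eps l a != 0 -> exists s : 'S_N, forall i, l i = (a i + s i)%N.
Proof.
move=> nz; case: (pickP (fun s : 'S_N => [forall i, l i == a i + s i]%N)) => [s /forallP ls | no_s].
  by exists s => i; apply/eqP.
by case/eqP: nz; rewrite alt_epsE big1 // => s _; rewrite no_s mulr0.
Qed.

Lemma sum_perm_ord s : (\sum_i s i = 'C(N, 2))%N.
Proof. by rewrite -bin2_sum big_mkord [RHS](reindex_inj (@perm_inj _ s)). Qed.

Lemma alt_eps_sum l a : alt_eps l a != 0 -> (\sum_i l i = \sum_i a i + 'C(N, 2))%N.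
Proof.
case/alt_eps_neq0=> s ls; rewrite -(sum_perm_ord s) -big_split /=.
by apply: eq_bigr => i _.
Qed.

Lemma alt_eps_le l a : alt_eps l a != 0 -> forall i, (a i <= l i)%N.
Proof. by case/alt_eps_neq0=> s ls i; rewrite ls leq_addr. Qed.

Lemma alt_eps_add l a r i :
  alt_eps l (add_at r i a) = if (r <= l i)%N then alt_eps (sub_at r i l) a else 0.
Proof.
case: leqP => [ler | gtr].
  congr (\det _); apply/matrixP=> k j; rewrite !mxE !ffunE; congr (nat_of_bool _)%:R.
  case: (eqVneq i k) => [<-|_]; last by rewrite muln0 addn0 subn0.
  by rewrite muln1 addnAC -[in RHS](eqn_add2r r) subnK.
apply/eqP; apply: contraTT gtr => /alt_eps_le/(_ i); rewrite ffunE eqxx muln1 -leqNgt.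
by apply: leq_trans; rewrite leq_addl.
Qed.

Definition row_sums (A : {ffun 'I_N * 'I_N -> nat}) : {ffun 'I_N -> nat} := [ffun i => \sum_j A (i, j)]%N.
Definition col_sums (A : {ffun 'I_N * 'I_N -> nat}) : {ffun 'I_N -> nat} := [ffun j => \sum_i A (i, j)]%N.

Lemma row_sums_add A r i j : row_sums (add_at r (i, j) A) = add_at r i (row_sums A).
Proof.
apply/ffunP=> k; rewrite !ffunE; under eq_bigr do rewrite ffunE xpair_eqE.
rewrite big_split /=; congr (_ + _)%N; rewrite (bigD1 j) //= eqxx andbT big1 ?addn0 // => j' nj.
by rewrite [j == _]eq_sym (negPf nj) andbF muln0.
Qed.

Lemma col_sums_add A r i j : col_sums (add_at r (i, j) A) = add_at r j (col_sums A).
Proof.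
apply/ffunP=> k; rewrite !ffunE; under eq_bigr do rewrite ffunE xpair_eqE.
rewrite big_split /=; congr (_ + _)%N; rewrite (bigD1 i) //= eqxx big1 ?addn0 // => j' nj.
by rewrite [i == _]eq_sym (negPf nj) muln0.
Qed.

Definition cauchy_term l m A := alt_eps l (row_sums A) * alt_eps m (col_sums A).

Definition natA M (A : {ffun 'I_N * 'I_N -> 'I_M}) : {ffun 'I_N * 'I_N -> nat} := [ffun x => val (A x)].

(* The coefficients of Cauchy's determinant det (1 / (1 - x_i y_j)), computed by
   cauchy_sumE. *)
Definition cauchy_sum M l m := \sum_(A : {ffun 'I_N * 'I_N -> 'I_M}) cauchy_term l m (natA A).

Lemma cauchy_term_neq0 l m A : cauchy_term l m A != 0 ->
  [/\ (\sum_i l i = \sum_x A x + 'C(N, 2))%N & forall i j, (A (i, j) <= l i)%N].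
Proof.
rewrite mulf_eq0 negb_or => /andP[nzl _]; split.
  rewrite (alt_eps_sum nzl); congr (_ + _)%N.
  under eq_bigr do rewrite ffunE.
  by rewrite pair_bigA; apply: eq_bigr => -[].
move=> i j; apply: leq_trans (alt_eps_le nzl i).
by rewrite ffunE (bigD1 j) //= leq_addr.
Qed.

Lemma cauchy_term_add l m A r i j :
  cauchy_term l m (add_at r (i, j) A) =
  if (r <= l i)%N && (r <= m j)%N then cauchy_term (sub_at r i l) (sub_at r j m) A else 0.
Proof.
rewrite /cauchy_term row_sums_add col_sums_add !alt_eps_add.
by do 2!case: leqP => _; rewrite ?mul0r ?mulr0.
Qed.

(** Subtracting r from the entry [x] of A is a bijection up to the bound on the entries. The bound
    is harmless: a nonzero term has [A (i, j) <= l i]. *)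
Lemma cauchy_sum_shift M l m x (r : nat) : (forall i, l i < M.+1)%N ->
  \sum_(A : {ffun 'I_N * 'I_N -> 'I_M.+1} | (r <= A x)%N) cauchy_term l m (natA A)
   = if (r <= l x.1)%N && (r <= m x.2)%N then cauchy_sum M.+1 (sub_at r x.1 l) (sub_at r x.2 m) else 0.
Proof.
case: x => i j ltM /=.
pose h (A : {ffun 'I_N * 'I_N -> 'I_M.+1}) : {ffun 'I_N * 'I_N -> 'I_M.+1} :=
  [ffun y => inord (A y + r * ((i, j) == y))].
pose h' (A : {ffun 'I_N * 'I_N -> 'I_M.+1}) : {ffun 'I_N * 'I_N -> 'I_M.+1} :=
  [ffun y => inord (A y - r * ((i, j) == y))].
have hE (A : {ffun 'I_N * 'I_N -> 'I_M.+1}) : (A (i, j) + r < M.+1)%N -> natA (h A) = add_at r (i, j) (natA A).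
  move=> ltA; apply/ffunP=> y; rewrite !ffunE /= inordK //.
  by case: eqVneq => [<- | _]; rewrite ?muln1 ?muln0 ?addn0.
rewrite (reindex_onto h h') => [|A leA]; last first.
  have ltA y : (A y - r * ((i, j) == y) < M.+1)%N by apply: leq_ltn_trans (leq_subr _ _) _.
  apply/ffunP=> y; apply: val_inj; rewrite !ffunE /= (inordK (ltA y)).
  have -> : (A y - r * ((i, j) == y) + r * ((i, j) == y) = A y)%N.
    by case: eqVneq => [<- | _]; rewrite ?muln1 ?muln0 ?addn0 ?subn0 ?subnK.
  by rewrite inordK.
have condE (A : {ffun 'I_N * 'I_N -> 'I_M.+1}) : (r <= h A (i, j))%N && (h' (h A) == A) = (A (i, j) + r < M.+1)%N.
  apply/andP/idP => [[leh /eqP hK] | ltA].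
    rewrite ltnNge; apply/negP => geA.
    move: leh; rewrite ffunE eqxx muln1 val_insubd ltnNge geA /= leqn0 => /eqP r0.
    by move: geA; rewrite r0 addn0 leqNgt ltn_ord.
  split; first by rewrite ffunE eqxx muln1 inordK // leq_addl.
  have ltA' y : (A y + r * ((i, j) == y) < M.+1)%N.
    by case: eqVneq => [<- | _]; rewrite ?muln1 ?muln0 ?addn0.
  by apply/eqP/ffunP=> y; apply: val_inj; rewrite !ffunE /= (inordK (ltA' y)) addnK inordK.
rewrite (eq_bigl _ _ condE).
transitivity (\sum_(A : {ffun 'I_N * 'I_N -> 'I_M.+1} | (A (i, j) + r < M.+1)%N)
    cauchy_term l m (add_at r (i, j) (natA A))).
  by apply: eq_bigr => A ltA; rewrite hE.
under eq_bigr => A _ do rewrite cauchy_term_add.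
case: ifP => [/andP[ler _] | _]; last by rewrite big1.
rewrite big_mkcond; apply: eq_bigr => A _; case: ifP => // /negbT geA.
apply/eqP; apply: contraNT geA; rewrite eq_sym => /cauchy_term_neq0[_ /(_ i j)].
rewrite !ffunE /= eqxx muln1 => leA.
by rewrite ltnS (leq_trans (leq_add leA (leqnn r))) // subnK // -ltnS ltM.
Qed.

(** An Euler operator: on nonzero terms the factor on the left is the total of the entries of A.
    Each entry is expanded by [sum_pos_le], and the resulting r is shifted out of A. *)
Lemma cauchy_sum_rec M l m : (forall i, l i < M.+1)%N ->
  ((\sum_i l i)%:R - 'C(N, 2)%:R) * cauchy_sum M.+1 l m =
  \sum_i \sum_j \sum_(r < M.+1 | (0 < r)%N && (r <= l i)%N && (r <= m j)%N)
     cauchy_sum M.+1 (sub_at r i l) (sub_at r j m).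
Proof.
move=> ltM.
transitivity (\sum_(A : {ffun 'I_N * 'I_N -> 'I_M.+1}) \sum_x
   \sum_(r < M.+1 | (0 < r)%N && (r <= A x)%N) cauchy_term l m (natA A)).
  rewrite mulr_sumr; apply: eq_bigr => A _.
  have -> : ((\sum_i l i)%:R - 'C(N, 2)%:R) * cauchy_term l m (natA A)
     = (\sum_x natA A x)%:R * cauchy_term l m (natA A).
    have [-> | /cauchy_term_neq0[-> _]] := eqVneq (cauchy_term l m (natA A)) 0; first by rewrite !mulr0.
    by rewrite natrD addrK.
  rewrite natr_sum mulr_suml; apply: eq_bigr => x _.
  rewrite [natA A x]ffunE /= -[X in X%:R](sum_pos_le (ltn_ord (A x))) natr_sum mulr_suml.
  by apply: eq_bigr => r _; rewrite mul1r.
rewrite exchange_big /= [RHS]pair_bigA; apply: eq_bigr => -[i j] _ /=.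
rewrite (exchange_big_dep (fun r : 'I_M.+1 => 0 < r)%N) /=; last by move=> A r _ /andP[].
rewrite big_mkcond [RHS]big_mkcond; apply: eq_bigr => r _; case: (0 < r)%N => //=.
exact: (cauchy_sum_shift m (i, j)).
Qed.

Lemma sub_at_sum l r i : (r <= l i)%N -> (\sum_k sub_at r i l k + r = \sum_k l k)%N.
Proof.
move=> ler; rewrite (bigD1 i) //= [RHS](bigD1 i) //= ffunE eqxx muln1.
rewrite (eq_bigr l) => [|k]; first by rewrite addnAC subnK.
by rewrite eq_sym ffunE => /negPf->; rewrite muln0 subn0.
Qed.

Lemma alt_eps_inj l a : (forall i k, a i = a k) -> alt_eps l a != 0 -> injective l.
Proof.
move=> ca nz i k elik; apply/eqP; apply: contraNT nz => nik; apply/eqP.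
by apply: (determinant_alternate nik) => j; rewrite !mxE elik (ca i k).
Qed.

(** Both sides obey the same recursion, by [cauchy_sum_rec] and [sum_alt_delta_sub]. The factor
    there is invertible when the total of [l] exceeds 'C(N, 2); below, both sides vanish; in the
    case of equality only A = 0 contributes. *)
Lemma cauchy_sumE M l m : (forall i, l i < M.+1)%N -> (\sum_i l i = \sum_i m i)%N ->
  cauchy_sum M.+1 l m = alt_delta l m.
Proof.
have [e] := ubnP (\sum_i l i)%N; elim: e l m => // e IHe l m ltse ltM eqs.
have [ltC | gtC | eqC] := ltngtP (\sum_i l i)%N 'C(N, 2).
- rewrite /cauchy_sum big1 => [|A _].
    apply/esym/eqP; apply: contraTT ltC => /alt_delta_inj/beta_sum_ge.
    by rewrite -leqNgt.
  apply/eqP; apply: contraTT ltC => /cauchy_term_neq0[-> _].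
  by rewrite -leqNgt leq_addl.
- have nz : (\sum_i l i)%:R - 'C(N, 2)%:R != 0 :> algC.
    by rewrite subr_eq0 eqr_nat neq_ltn gtC orbT.
  apply: (mulfI nz); rewrite cauchy_sum_rec // -(sum_alt_delta_sub m ltM).
  apply: eq_bigr => i _; apply: eq_bigr => j _; apply: eq_bigr => r /andP[/andP[r_gt0 lerl] lerm].
  have := sub_at_sum lerl; have := sub_at_sum lerm => sm sl.
  apply: IHe => [|k|]; [by lia | | by lia].
  by rewrite ffunE (leq_ltn_trans (leq_subr _ _)).
have natA0 (A : {ffun 'I_N * 'I_N -> 'I_M.+1}) : cauchy_term l m (natA A) != 0 -> natA A = [ffun=> 0%N].
  case/cauchy_term_neq0; rewrite eqC -[X in X = _]add0n => /eqP.
  rewrite eqn_add2r eq_sym sum_nat_eq0 => /forallP A0 _.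
  by apply/ffunP=> x; rewrite [RHS]ffunE; apply/eqP/A0.
pose zero : {ffun 'I_N -> nat} := [ffun=> 0%N].
have -> : cauchy_sum M.+1 l m = alt_eps l zero * alt_eps m zero.
  rewrite /cauchy_sum (bigD1 [ffun=> ord0]) //= [X in _ + X]big1 ?addr0 => [|A nA]; last first.
    apply/eqP; apply: contraNT nA => /natA0 /ffunP A0; apply/eqP/ffunP=> x; apply: val_inj.
    by have := A0 x; rewrite !ffunE.
  congr (alt_eps l _ * alt_eps m _); apply/ffunP=> i; rewrite !ffunE big1 // => j _; by rewrite !ffunE.
have eqDE (l0 m0 : {ffun 'I_N -> nat}) : (forall i, l0 i < N)%N ->
    alt_eps l0 zero * alt_eps m0 zero = alt_delta l0 m0.
  (* The matrices are (l0 i == k) and (m0 j == k); as [l0 i < N] is itself one of the indices k, the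
     first times the transpose of the second is (l0 i == m0 j). *)
  move=> ltN; rewrite /alt_eps -[X in _ * X]det_tr -det_mulmx; congr (\det _).
  apply/matrixP=> i j; rewrite !mxE (bigD1 (Ordinal (ltN i))) //= !mxE !ffunE !add0n eqxx mul1r.
  rewrite big1 ?addr0 1?eq_sym // => k; rewrite -val_eqE /= eq_sym => /negPf nk.
  by rewrite !mxE !ffunE add0n nk mul0r.
have [/injectiveP injl | ninjl] := boolP (injectiveb l).
  by apply: eqDE => i; apply: beta_sum_eq.
have -> : alt_delta l m = 0 by apply/eqP; apply: contraNT ninjl => /alt_delta_inj/injectiveP.
have -> : alt_eps l zero = 0; last by rewrite mul0r.
apply/eqP; apply: contraNT ninjl => /alt_eps_inj H; apply/injectiveP; apply: H => i k.
by rewrite !ffunE.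
Qed.

End CauchySum.

(** * Orthogonality of the characters of beta-sets *)

Section BetaCharacters.
Variables n N : nat.
Implicit Types (l m a : {ffun 'I_N -> nat}) (g : {perm 'I_n}).

(* For l with distinct entries, this is up to sign the Specht character of the partition
   with beta-set l. *)
Definition beta_char l g : algC :=
  \sum_(w : {ffun 'I_n -> 'I_N} | fixes_word g w) alt_eps l (content w).

Lemma alt_eps_int l a : alt_eps l a \is a Num.int.
Proof.
rewrite alt_epsE; apply: rpred_sum => s _; apply: rpredM; last exact: rpred_nat.
by rewrite rpredX // rpredN rpred1.
Qed.

Lemma beta_char_int l g : beta_char l g \is a Num.int.
Proof. by apply: rpred_sum => w _; apply: alt_eps_int. Qed.

Lemma alt_eps_tperm l a (i k : 'I_N) : i != k ->
  alt_eps [ffun x => l (tperm i k x)] [ffun x => a (tperm i k x)] = - alt_eps l a.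
Proof.
move=> nik; rewrite !alt_epsE -sumrN [LHS](reindex_inj (mulgI (tperm i k))); apply: eq_bigr => s _.
rewrite odd_permM odd_tperm nik signr_addb expr1 mulN1r mulNr; congr (- (_ * (nat_of_bool _)%:R)).
apply/forallP/forallP => ls x; last by rewrite !ffunE permM.
by have := ls (tperm i k x); rewrite !ffunE permM tpermK.
Qed.

(** If [l i = l k] with i != k, exchanging the letters i and k in all words negates the sum. *)
Lemma beta_char_inj l g : beta_char l g != 0 -> injective l.
Proof.
move=> nz i k eqlik; apply/eqP; apply: contraNT nz => nik; rewrite -eqNr; apply/eqP.
pose h (w : {ffun 'I_n -> 'I_N}) : {ffun 'I_n -> 'I_N} := [ffun x => tperm i k (w x)].
have hK : involutive h by move=> w; apply/ffunP=> x; rewrite !ffunE tpermK.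
rewrite /beta_char [RHS](reindex_inj (inv_inj hK)) -sumrN; apply: eq_big => [w | w _].
  by apply: eq_forallb => x; rewrite !ffunE (inj_eq perm_inj).
rewrite -(alt_eps_tperm _ _ nik); congr (alt_eps _ _); apply/ffunP=> x; rewrite !ffunE.
  by case: tpermP => [-> | -> | //]; rewrite eqlik.
apply: eq_bigr => y _; rewrite ffunE; congr (nat_of_bool _).
by rewrite -[RHS](inj_eq (@perm_inj _ (tperm i k))) tpermK.
Qed.

Lemma alt_delta_diag l : injective l -> alt_delta l l = 1.
Proof.
move=> injl; rewrite alt_deltaE (bigD1 1%g) //= odd_perm1 mul1r.
have -> : [forall i, l i == l ((1%g : 'S_N) i)] by apply/forallP=> i; rewrite perm1.
rewrite big1 ?addr0 // => s; case: forallP => [ls | _ _]; last by rewrite mulr0.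
case/eqP; apply/permP=> i; rewrite perm1; apply: injl; exact/esym/eqP.
Qed.

(** Two words fixed by g form one fixed word over pairs of letters, whose content is a matrix with
    the two contents as row and column sums. Summing over g by [sum_perm_words] yields the Cauchy
    sum. *)
Lemma beta_char_ortho l m : (\sum_i l i = n + 'C(N, 2))%N -> (\sum_i m i = n + 'C(N, 2))%N ->
  \sum_g beta_char l g * beta_char m g = n`!%:R * alt_delta l m.
Proof.
move=> sl sm; pose M := (n + \sum_i l i)%N.
have ltM i : (l i < M.+1)%N by rewrite ltnS /M (bigD1 i) //= addnCA leq_addr.
rewrite -(cauchy_sumE ltM) ?sl ?sm //.
have E g : beta_char l g * beta_char m g
    = \sum_(w : {ffun 'I_n -> 'I_N * 'I_N} | fixes_word g w) cauchy_term l m (content w).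
  rewrite /beta_char big_distrlr pair_big_dep /=.
  pose h (w : {ffun 'I_n -> 'I_N * 'I_N}) := ([ffun i => (w i).1], [ffun i => (w i).2]) : {ffun 'I_n -> 'I_N} * {ffun 'I_n -> 'I_N}.
  pose h' (p : {ffun 'I_n -> 'I_N} * {ffun 'I_n -> 'I_N}) : {ffun 'I_n -> 'I_N * 'I_N} := [ffun i => (p.1 i, p.2 i)].
  have hK : cancel h h' by move=> w; apply/ffunP=> i; rewrite !ffunE /= ?ffunE; case: (w i).
  have h'K : cancel h' h by case=> w w'; congr (_, _); apply/ffunP=> i; rewrite !ffunE.
  rewrite (reindex h) /=; last by exists h' => w _; [apply: hK | apply: h'K].
  apply: eq_big => [w | w _]; last first.
    rewrite /cauchy_term; congr (alt_eps l _ * alt_eps m _); apply/ffunP=> x; rewrite !ffunE.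
      under [RHS]eq_bigr do rewrite ffunE.
      rewrite exchange_big; apply: eq_bigr => i _; rewrite /= ffunE; case: (w i) => u v /=.
      rewrite (bigD1 v) //= xpair_eqE eqxx andbT big1 ?addn0 // => y.
      by rewrite xpair_eqE eq_sym => /negPf->; rewrite andbF.
    under [RHS]eq_bigr do rewrite ffunE.
    rewrite exchange_big; apply: eq_bigr => i _; rewrite /= ffunE; case: (w i) => u v /=.
    rewrite (bigD1 u) //= xpair_eqE eqxx big1 ?addn0 // => y.
    by rewrite xpair_eqE eq_sym => /negPf->.
  apply/andP/forallP => [[/forallP f1 /forallP f2] i | fw].
    have := f1 i; have := f2 i; rewrite !ffunE => /eqP E2 /eqP E1.
    by rewrite [w (g i)]surjective_pairing E1 E2 -surjective_pairing.
  by split; apply/forallP=> i; rewrite !ffunE (eqP (fw i)).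
under eq_bigr do rewrite E.
rewrite (@sum_perm_words _ _ M.+1) ?ltnS ?leq_addr //; congr (_ * _).
rewrite big_mkcond; apply: eq_bigr => A _; case: eqP => // nA.
apply/eqP; apply: contra_notT nA; rewrite eq_sym => /cauchy_term_neq0[].
rewrite sl => /eqP; rewrite eqn_add2r => /eqP-> _.
by apply: eq_bigr => x _; rewrite ffunE.
Qed.

Lemma rank_perm a : exists r : 'S_N, forall i k, (a i < a k)%N -> (r i < r k)%N.
Proof.
pose lt i j := (a i < a j)%N || ((a i == a j) && (i < j)%N).
pose f i := #|[set j | lt j i]|.
have ltf i k : lt i k -> (f i < f k)%N.
  move=> ltik; apply: proper_card; apply/properP; split.
    by apply/subsetP=> j; rewrite !inE; move: ltik; rewrite /lt; lia.
  by exists i; rewrite !inE // /lt; lia.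
have fN i : (f i < N)%N.
  rewrite /f -[ltnRHS]card_ord; apply/proper_card/properP; split; first exact/subsetP.
  by exists i; rewrite ?inE //; rewrite /lt; lia.
have injf : injective (fun i => Ordinal (fN i)).
  move=> i k [eqf]; apply/eqP; case: eqP => // /eqP nik.
  have [/ltf | /ltf] : lt i k \/ lt k i; [|by rewrite eqf ltnn | by rewrite eqf ltnn].
  by move: nik; rewrite -val_eqE /lt /=; lia.
by exists (perm injf) => i k ltik; rewrite !permE /=; apply: ltf; rewrite /lt ltik.
Qed.

End BetaCharacters.

(** * Beta-sets give all irreducible characters *)

Section Completeness.
Variable n : nat.
Implicit Types (l m a : {ffun 'I_n -> nat}) (g : {perm 'I_n}).

(** This is n! times the inner product of [f] with the permutation character on the words of content
    [a]. *)
Definition word_mult (f : {perm 'I_n} -> algC) a : algC :=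
  \sum_g f g * (\sum_(w : {ffun 'I_n -> 'I_n} | fixes_word g w) (content w == a)%:R).

Lemma sum_beta_char f l : \sum_(g : {perm 'I_n}) f g * beta_char l g
   = \sum_(s : 'S_n) (-1) ^+ s * (if [forall i, (s i <= l i)%N] then word_mult f [ffun i => (l i - s i)%N] else 0).
Proof.
have E g : beta_char l g = \sum_(s : 'S_n) (-1) ^+ s * (if [forall i, (s i <= l i)%N] then
   \sum_(w : {ffun 'I_n -> 'I_n} | fixes_word g w) (content w == [ffun i => (l i - s i)%N])%:R else 0).
  rewrite /beta_char; under eq_bigr do rewrite alt_epsE.
  rewrite exchange_big; apply: eq_bigr => s _; rewrite -mulr_sumr; congr (_ * _).
  case: ifP => [/forallP les | nles].
    apply: eq_bigr => w _; congr (nat_of_bool _)%:R; apply/forallP/eqP => [ls | wE i].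
      by apply/ffunP=> i; rewrite [RHS]ffunE (eqP (ls i)) addnK.
    by rewrite wE ffunE subnK.
  rewrite big1 // => w _; case: forallP => // ls; case/negP: (negbT nles).
  by apply/forallP=> i; rewrite (eqP (ls i)) leq_addl.
under eq_bigr do rewrite E mulr_sumr.
rewrite exchange_big; apply: eq_bigr => s _ /=; under eq_bigr do rewrite mulrCA.
rewrite -mulr_sumr; congr (_ * _); case: ifP => _ //.
by rewrite big1 // => g _; rewrite mulr0.
Qed.

(** The words of content (1, ..., 1) are the bijections, and no g != 1 fixes any: they carry a
    multiple of the regular character. *)
Lemma word_mult1 f : exists2 k, (0 < k)%N & word_mult f [ffun=> 1%N] = k%:R * f 1%g.
Proof.
have cont1 (w : {ffun 'I_n -> 'I_n}) : content w = [ffun=> 1%N] -> injective w.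
  move=> cw i j eqwij; apply/eqP; case: eqP => // /eqP nij.
  have := congr1 (fun c : {ffun 'I_n -> nat} => c (w i)) cw; rewrite !ffunE (bigD1 i) //= (bigD1 j) 1?eq_sym //=.
  by rewrite eqwij eqxx.
exists (\sum_(w : {ffun 'I_n -> 'I_n}) (content w == [ffun=> 1%N]))%N.
  rewrite (bigD1 [ffun i => i]) //= addn_gt0; apply/orP; left; rewrite lt0b.
  apply/eqP/ffunP=> x; rewrite !ffunE (bigD1 x) //= ffunE eqxx big1 // => i /negPf nix.
  by rewrite ffunE nix.
rewrite /word_mult (bigD1 1%g) //= [X in _ + X]big1 ?addr0 => [|g g1]; last first.
  rewrite big1 ?mulr0 // => w /forallP fw; case: eqP => // /cont1 injw.
  by case/eqP: g1; apply/permP=> i; rewrite perm1; apply: injw; apply/eqP.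
rewrite mulrC; congr (_ * _).
rewrite (eq_bigl xpredT) => [|w]; last by apply/forallP=> i; rewrite perm1.
by rewrite -natr_sum.
Qed.

(* Take a content a of maximal weight sum_i (n + 1) ^ a i with nonzero word_mult,
   and l = a + r for a ranking r of a: all the other terms of the determinant
   involve contents of larger weight. *)
Lemma beta_char_complete f : (0 < n)%N -> f 1%g != 0 ->
  exists l, \sum_(g : {perm 'I_n}) f g * beta_char l g != 0.
Proof.
move=> n_gt0 nzf1; have [k k_gt0 kE] := word_mult1 f.
have nz1 : word_mult f [ffun=> 1%N] != 0 by rewrite kE mulf_neq0 // pnatr_eq0 -lt0n.
pose va (a : {ffun 'I_n -> 'I_n.+1}) : {ffun 'I_n -> nat} := [ffun i => val (a i)].
have vaS a : (forall i, a i <= n)%N -> a = va [ffun i => inord (a i)].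
  by move=> lea; apply/ffunP=> i; rewrite !ffunE /= inordK ?ltnS.
pose P (a : {ffun 'I_n -> 'I_n.+1}) := word_mult f (va a) != 0.
pose Phi (a : {ffun 'I_n -> nat}) := (\sum_(i < n) n.+1 ^ a i)%N.
have P1 : P [ffun=> inord 1].
  by rewrite /P; have -> : va [ffun=> inord 1] = [ffun=> 1%N] by apply/ffunP=> i; rewrite !ffunE /= inordK.
case: (arg_maxnP (fun b : {ffun 'I_n -> 'I_n.+1} => Phi (va b)) P1) => a nza maxa.
have [r rP] := rank_perm (va a).
pose l : {ffun 'I_n -> nat} := [ffun i => (va a i + r i)%N].
exists l; apply/eqP; rewrite sum_beta_char (bigD1 r) //= [X in _ + X]big1 ?addr0 => [|s nsr].
  have -> : [forall i, (r i <= l i)%N] by apply/forallP=> i; rewrite ffunE leq_addl.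
  have -> : [ffun i => (l i - r i)%N] = va a by apply/ffunP=> i; rewrite !ffunE addnK.
  by move/eqP; rewrite mulf_eq0 signr_eq0 (negPf nza).
case: ifP => [/forallP les | _]; last by rewrite mulr0.
set b := [ffun i => _]; suff -> : word_mult f b = 0 by rewrite mulr0.
apply/eqP/idPn => nzb.
have leb i : (b i <= n)%N.
  have [w wb] : exists w : {ffun 'I_n -> 'I_n}, content w = b.
    case: (pickP (fun w : {ffun 'I_n -> 'I_n} => content w == b)) => [w /eqP|no_w]; first by exists w.
    case/eqP: nzb; rewrite /word_mult big1 // => g _; rewrite big1 ?mulr0 // => w _.
    by rewrite no_w.
  by rewrite -wb -[leqRHS](sum_content w) (bigD1 i) //= leq_addr.
have := maxa [ffun i => inord (b i)]; rewrite /P -vaS // => /(_ nzb); apply/negP; rewrite -ltnNge.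
(* Here [i0] has the largest rank among the places where s and r differ. Places of higher rank
   agree, whence s i0 < r i0 and b i0 > a i0; the at most n other places, with exponents at most a
   i0, are outweighed in base n + 1. *)
have [i0 [n0 max0]] : exists i, s i != r i /\ forall j, s j != r j -> (r j <= r i)%N.
  have [i ni] : exists i, s i != r i.
    by apply/existsP; apply: contraNT nsr; rewrite negb_exists => /forallP E; apply/eqP/permP=> i; apply/eqP; have := E i; rewrite negbK.
  by case: (@arg_maxnP _ i (fun i => s i != r i) (fun i => nat_of_ord (r i)) ni) => j nj maxj; exists j; split.
have lt0 : (s i0 < r i0)%N.
  rewrite ltn_neqAle val_eqE n0 leqNgt; apply/negP => gt0.
  have E : s (r^-1%g (s i0)) = r (r^-1%g (s i0)).
    apply/eqP/negbNE/negP => /max0; rewrite permKV; lia.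
  by move: E; rewrite permKV => /perm_inj E; move: n0; rewrite -{2}E permKV eqxx.
rewrite /Phi (bigID (fun i => r i0 < r i)%N) [ltnRHS](bigID (fun i => r i0 < r i)%N) /=.
have -> : (\sum_(i < n | (r i0 < r i)%N) n.+1 ^ b i = \sum_(i < n | (r i0 < r i)%N) n.+1 ^ va a i)%N.
  apply: eq_bigr => i lti; congr (_ ^ _)%N; rewrite /b ffunE /l ffunE.
  have -> : s i = r i by apply/eqP/negbNE/negP => /max0; rewrite leqNgt lti.
  by rewrite addnK.
rewrite ltn_add2l; apply: (@leq_ltn_trans (\sum_(i < n) n.+1 ^ va a i0)%N).
  rewrite big_mkcond; apply: leq_sum => i _; case: ifP => // nlt.
  rewrite leq_exp2l // leqNgt; apply/negP => /rP; by rewrite (negPf nlt).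
rewrite sum_nat_const card_ord (bigD1 i0) ?ltnn //=; apply: leq_trans (leq_addr _ _).
apply: leq_trans (_ : n.+1 ^ (va a i0).+1 <= _)%N; first by rewrite expnS ltn_pmul2r ?expn_gt0.
have -> : b i0 = (va a i0 + (r i0 - s i0))%N by rewrite /b ffunE /l ffunE addnBA // ltnW.
by rewrite leq_exp2l // -addn1 leq_add2l subn_gt0.
Qed.

(** The inner product c of [chi] with a suitable beta character is nonzero, and an integer by
    [weighted_words]. As both have norm 1, [chi - c * beta_char l] has norm 1 - c^2 >= 0, so c is 1
    or -1 and the difference is zero. *)
Lemma irr_beta_char (chi : 'CF([set: {perm 'I_n}])) : (0 < n)%N -> chi \in irr [set: {perm 'I_n}] ->
  exists l, [/\ injective l, (\sum_i l i = n + 'C(n, 2))%N &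
    (forall g, chi g = beta_char l g) \/ (forall g, chi g = - beta_char l g)].
Proof.
move=> n_gt0 irr_chi; have Nchi := irrWchar irr_chi.
have chi1 : chi 1%g != 0 by case/irrP: irr_chi => i ->; apply: irr1_neq0.
have [l nzl] := beta_char_complete n_gt0 chi1.
have [g0 nzg0] : exists g0, beta_char l g0 != 0.
  apply/existsP; apply: contraNT nzl; rewrite negb_exists => /forallP z.
  by apply/eqP/big1 => g _; have := z g; rewrite negbK => /eqP->; rewrite mulr0.
have [w0 nzw] : exists w0 : {ffun 'I_n -> 'I_n}, alt_eps l (content w0) != 0.
  apply/existsP; apply: contraNT nzg0; rewrite negb_exists => /forallP z.
  by apply/eqP/big1 => w _; have := z w; rewrite negbK => /eqP.
have injl := beta_char_inj nzg0.
have sl : (\sum_i l i = n + 'C(n, 2))%N by rewrite (alt_eps_sum nzw) sum_content.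
exists l; split=> //.
have [s sE] := weighted_words 'I_n Nchi.
have {sE} := sE (fun w => alt_eps l (content w)) (fun w g _ => congr1 (alt_eps l) (content_act w g)).
rewrite cardsT card_Sn; set c := \sum_(x <- s) _ => cE.
have {}cE : \sum_(g : {perm 'I_n}) chi g * beta_char l g = n`!%:R * c.
  by rewrite -cE; apply: eq_bigl => g; rewrite inE.
have cZ : c \is a Num.int.
  by apply: rpred_sum => x _; rewrite rpredM ?rpred_nat ?alt_eps_int.
have c0 : c != 0 by apply: contraNneq nzl => c0; rewrite cE c0 mulr0.
have nf0 : n`!%:R != 0 :> algC by rewrite pnatr_eq0 -lt0n fact_gt0.
have realb g : (beta_char l g)^* = beta_char l g by rewrite conj_intr // beta_char_int.
have realc : c^* = c by rewrite conj_intr.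
have normchi : \sum_(g : {perm 'I_n}) chi g * (chi g)^* = n`!%:R.
  have := irrWnorm irr_chi; rewrite cfdotE cardsT card_Sn => /(canRL (mulVKf nf0)).
  by rewrite mulr1 => <-; apply: eq_bigl => g; rewrite inE.
have cEc : \sum_(g : {perm 'I_n}) (chi g)^* * beta_char l g = n`!%:R * c.
  rewrite -realc -[n`!%:R]conjC_nat -rmorphM -cE rmorph_sum; apply: eq_bigr => g _.
  by rewrite rmorphM /= realb.
have nn : \sum_(g : {perm 'I_n}) (chi g - c * beta_char l g) * (chi g - c * beta_char l g)^*
   = n`!%:R * (1 - c ^+ 2).
  transitivity (\sum_(g : {perm 'I_n}) (chi g * (chi g)^* - c * (chi g * beta_char l g)
     - c * ((chi g)^* * beta_char l g) + c ^+ 2 * (beta_char l g * beta_char l g))).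
    by apply: eq_bigr => g _; rewrite rmorphB rmorphM /= realc realb; ring.
  rewrite !big_split /= !sumrN -!mulr_sumr normchi cE cEc beta_char_ortho // alt_delta_diag //.
  by ring.
have nn0 g : true -> 0 <= (chi g - c * beta_char l g) * (chi g - c * beta_char l g)^*.
  by move=> _; apply: mul_conjC_ge0.
have c1 : c ^+ 2 = 1.
  apply/eqP; rewrite eq_le; apply/andP; split.
    have : 0 <= n`!%:R * (1 - c ^+ 2) by rewrite -nn; apply: sumr_ge0.
    by rewrite pmulr_rge0 ?subr_ge0 // ltr0n fact_gt0.
  by rewrite -intr_normK // exprn_ege1 // norm_intr_ge1.
have chiE g : chi g = c * beta_char l g.
  have : \sum_(g : {perm 'I_n}) (chi g - c * beta_char l g) * (chi g - c * beta_char l g)^* == 0.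
    by rewrite nn c1 subrr mulr0.
  rewrite psumr_eq0 // => /allP/(_ g (mem_index_enum g)); rewrite mul_conjC_eq0 subr_eq0.
  by move/eqP.
move/eqP: c1; rewrite sqrf_eq1 => /orP[] /eqP c1; [left | right] => g; rewrite chiE c1 ?mul1r //.
by rewrite mulN1r.
Qed.

End Completeness.

(** * Hook removal and degrees *)

Section HookRemoval.
Variable N : nat.
Implicit Types (l m : {ffun 'I_N -> nat}) (i j k : 'I_N) (rs : seq nat).

Definition beta_sum l rs : algC := cycle_sum rs (alt_eps l).

(** The Murnaghan-Nakayama rule: subtracting r from an entry of a beta-set removes a rim hook of
    length r. The leg-length sign is implicit, since the entries are not sorted again. *)
Lemma beta_sum_cons l r rs :
  beta_sum l (r :: rs) = \sum_(i | (r <= l i)%N) beta_sum (sub_at r i l) rs.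
Proof.
rewrite /beta_sum /= [RHS]big_mkcond; apply: eq_bigr => i _.
rewrite (eq_cycle_sum _ (fun a => alt_eps_add l a r i)); case: ifP => // _.
by elim: rs => //= s rs IHrs; apply: big1.
Qed.

Lemma beta_sum_tperm l rs i k : i != k ->
  beta_sum [ffun x => l (tperm i k x)] rs = - beta_sum l rs.
Proof.
move=> nik; elim: rs l => [|r rs IHrs] l.
  rewrite /beta_sum /= -(alt_eps_tperm _ _ nik); congr alt_eps.
  by apply/ffunP=> x; rewrite !ffunE.
rewrite !beta_sum_cons [LHS](reindex_inj (@perm_inj _ (tperm i k))) -sumrN.
apply: eq_big => [x | x _]; first by rewrite ffunE tpermK.
rewrite -IHrs; congr beta_sum; apply/ffunP=> y; rewrite !ffunE; congr (_ - _ * nat_of_bool _)%N.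
by rewrite -[RHS](inj_eq (@perm_inj _ (tperm i k))) tpermK.
Qed.

Lemma beta_sum_inj l rs : beta_sum l rs != 0 -> injective l.
Proof.
move=> nz i k eqlik; apply/eqP; apply: contraNT nz => nik; rewrite -eqNr; apply/eqP.
rewrite -(beta_sum_tperm _ _ nik); congr beta_sum; apply/ffunP=> x; rewrite !ffunE.
by case: tpermP => [-> | -> | //]; rewrite eqlik.
Qed.

(** Some term of [beta_sum_cons] is nonzero. Removing a multiple r of q keeps the residues, hence
    the sum of ranks, and lowers the sum of quotients by r / q; [residue_rank_le] applies to what
    remains. *)
Lemma residue_rank_bound q l rs1 rs2 : (0 < q)%N -> all (dvdn q) rs1 ->
    beta_sum l (rs1 ++ rs2) != 0 ->
  (\sum_i residue_rank q l i + \sum_(r <- rs1) r %/ q <= \sum_i l i %/ q)%N.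
Proof.
move=> q_gt0; elim: rs1 l => [|r rs IHrs] l /=.
  move=> _ /beta_sum_inj injl; rewrite big_nil addn0; apply: leq_sum => i _.
  exact: residue_rank_le.
case/andP=> qr qrs nz; have injl := beta_sum_inj nz.
have [i ler nzi] : exists2 i, (r <= l i)%N & beta_sum (sub_at r i l) (rs ++ rs2) != 0.
  apply/exists_inP; apply: contraNT nz; rewrite negb_exists => /forallP z.
  by rewrite beta_sum_cons; apply/eqP/big1 => i ler; have := z i; rewrite ler negbK => /eqP.
have inji := beta_sum_inj nzi.
have le1 := IHrs _ qrs nzi.
have modE k : sub_at r i l k = l k %[mod q].
  rewrite ffunE; case: eqVneq => [<- | _]; last by rewrite muln0 subn0.
  by rewrite muln1 -[in RHS](subnK ler) -modnDmr (eqP qr) addn0.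
have rkE : (\sum_k residue_rank q (sub_at r i l) k = \sum_k residue_rank q l k)%N.
  apply/eqP; rewrite -(eqn_pmul2r (_ : 0 < 2)%N) // !sum_residue_rank //; apply/eqP.
  by apply: eq_bigr => j _; apply: eq_bigr => k _; rewrite !modE.
have divE : (\sum_k sub_at r i l k %/ q + r %/ q = \sum_k l k %/ q)%N.
  rewrite (bigD1 i) //= [RHS](bigD1 i) //= ffunE eqxx muln1 addnAC; congr (_ + _)%N.
    by rewrite -divnDr // subnK.
  by apply: eq_bigr => k; rewrite eq_sym ffunE => /negPf->; rewrite muln0 subn0.
by rewrite big_cons -divE addnA addnAC leq_add2r -rkE.
Qed.

(** The matrix of 1 / (l_i - j)! in the determinantal degree formula; the test replaces the
    truncated difference by the convention that 1 / x! is 0 for negative x. *)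
Definition inv_fact_mx l : 'M[algC]_N :=
  \matrix_(i, j) (if (j <= l i)%N then ((l i - j)`!)%:R^-1 else 0).

Lemma inv_fact_mx_sub l i (j : 'I_N) : (0 < l i)%N ->
  inv_fact_mx (sub_at 1 i l) i j = (l i - j)%:R * inv_fact_mx l i j.
Proof.
move=> l_gt0; rewrite !mxE ffunE eqxx mul1n.
have [lelj | ltjl | eqlj] := ltngtP (l i) j.
- by rewrite mulr0; have -> : (j <= l i - 1)%N = false by lia.
- have -> : (j <= l i - 1)%N by lia.
  have -> : (l i - j = (l i - 1 - j).+1)%N by lia.
  rewrite factS natrM invfM mulrA mulfV ?mul1r //.
  by rewrite pnatr_eq0.
by rewrite eqlj subnn mul0r; have -> : (j <= j - 1)%N = false by lia.
Qed.

Lemma det_inv_fact_rec l :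
  \sum_(i | (0 < l i)%N) \det (inv_fact_mx (sub_at 1 i l))
   = (\sum_i l i - 'C(N, 2))%:R * \det (inv_fact_mx l).
Proof.
rewrite /determinant exchange_big mulr_sumr; apply: eq_bigr => s _ /=.
rewrite -mulr_sumr mulrCA; congr (_ * _).
transitivity (\sum_i (l i - s i)%:R * \prod_k inv_fact_mx l k (s k)).
  rewrite big_mkcond; apply: eq_bigr => i _; case: posnP => [l0 | l_gt0].
    by rewrite l0 sub0n mul0r.
  rewrite (bigD1 i) //= [in RHS](bigD1 i) //= inv_fact_mx_sub // mulrA; congr (_ * _).
  by apply: eq_bigr => k; rewrite eq_sym => /negPf nik; rewrite !mxE ffunE nik muln0 subn0.
rewrite -mulr_suml -natr_sum.
have [-> | nz] := eqVneq (\prod_k inv_fact_mx l k (s k)) 0; first by rewrite !mulr0.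
congr (_%:R * _).
(* A nonzero product forces s k <= l k everywhere, so that the truncated differences add up to the
   difference of the totals. *)
have les k : (s k <= l k)%N.
  rewrite leqNgt; apply: contraNN nz => gts; apply/eqP; rewrite (bigD1 k) //= mxE.
  by rewrite leqNgt gts mul0r.
rewrite -(sum_perm_ord s) -sumnB //.
Qed.

Lemma beta_sum_nseq1 l (m : nat) : (\sum_i l i = m + 'C(N, 2))%N ->
  beta_sum l (nseq m 1%N) = m`!%:R * \det (inv_fact_mx l).
Proof.
elim: m l => [|m IHm] l sl.
  rewrite mul1r /beta_sum /= /alt_eps; apply: eq_bigr => s _; congr (_ * _).
  (* The totals of l and s agree, so if l differs from s then some l k is below s k, and both
     products contain a zero factor. *)
  rewrite add0n in sl; have [i nlis | all_eq] := pickP (fun i => l i != s i :> nat).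
    have [k ltk] : exists k, (l k < s k)%N.
      apply/existsP; apply: contraNT nlis; rewrite negb_exists => /forallP les.
      have {}les k : (s k <= l k)%N by rewrite leqNgt.
      have : (\sum_k (l k - s k) == 0)%N by rewrite sumnB // sl (sum_perm_ord s) subnn.
      by rewrite sum_nat_eq0 => /forall_inP/(_ i isT); rewrite subn_eq0 eqn_leq les andbT.
    rewrite (bigD1 k) //= [RHS](bigD1 k) //= !mxE ffunE add0n ltn_eqF // mul0r.
    by rewrite leqNgt ltk mul0r.
  apply: eq_bigr => i _; have /negbFE/eqP li := all_eq i.
  by rewrite !mxE ffunE add0n li eqxx leqnn subnn invr1.
rewrite /= beta_sum_cons (eq_bigr (fun i => m`!%:R * \det (inv_fact_mx (sub_at 1 i l)))).
  by rewrite -mulr_sumr det_inv_fact_rec sl addSn subSn ?leq_addl // addnK factS natrM; ring.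
by move=> i l_gt0; apply: IHm; have := sub_at_sum l_gt0; rewrite sl; lia.
Qed.

End HookRemoval.

(** * The degree as a Vandermonde product *)

Section Degrees.
Variable N : nat.
Implicit Types (l : {ffun 'I_N -> nat}) (i j k : 'I_N).

Definition ffact_poly (j : nat) : {poly algC} := \prod_(k < j) ('X - k%:R%:P).

Lemma horner_ffact_poly (x j : nat) : (ffact_poly j).[x%:R] = (x ^_ j)%:R.
Proof.
elim: j => [|j IHj]; first by rewrite /ffact_poly big_ord0 hornerC.
rewrite /ffact_poly big_ord_recr hornerM -/(ffact_poly j) IHj hornerXsubC ffactnSr natrM.
by have [lexj | ltjx] := leqP j x; [rewrite natrB | rewrite ffact_small ?mul0r].
Qed.

(** Falling factorials are monic of degree j, hence a unitriangular change of basis leads to the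
    Vandermonde matrix. *)
Lemma det_ffact l : \det (\matrix_(i, j) (l i ^_ j)%:R : 'M[algC]_N)
   = \prod_(i < N) \prod_(j < N | (i < j)%N) ((l j)%:R - (l i)%:R).
Proof.
pose a : 'rV[algC]_N := \row_i (l i)%:R.
have -> : \prod_(i < N) \prod_(j < N | (i < j)%N) ((l j)%:R - (l i)%:R)
    = \prod_(i < N) \prod_(j < N | (i < j)%N) (a 0 j - a 0 i).
  by apply: eq_bigr => i _; apply: eq_bigr => j _; rewrite !mxE.
rewrite -det_Vandermonde.
pose C : 'M[algC]_N := \matrix_(j, k) (ffact_poly j)`_k.
have szp j : size (ffact_poly j) = j.+1.
  by rewrite /ffact_poly size_prod_XsubC /index_enum -enumT size_enum_ord.
have monp j : ffact_poly j \is monic by apply: monic_prod_XsubC.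
have detC : \det C = 1.
  rewrite det_trig; last first.
    by apply/is_trig_mxP=> i j ltij; rewrite mxE nth_default // szp.
  apply: big1 => i _; rewrite mxE; have := monicP (monp i); rewrite lead_coefE szp.
  by [].
rewrite -[RHS]mul1r -[X in _ = X * _]detC -det_mulmx -[LHS]det_tr; congr (\det _).
apply/matrixP=> j i; rewrite !mxE -horner_ffact_poly.
rewrite (@horner_coef_wide _ N) ?szp //; apply: eq_bigr => k _.
by rewrite !mxE.
Qed.

Lemma det_inv_fact l : (\prod_i (l i)`!)%:R * \det (inv_fact_mx l)
   = \prod_(i < N) \prod_(j < N | (i < j)%N) ((l j)%:R - (l i)%:R).
Proof.
rewrite -det_ffact /determinant mulr_sumr; apply: eq_bigr => s _.
rewrite mulrCA; congr (_ * _); rewrite natr_prod -big_split /=; apply: eq_bigr => i _.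
rewrite !mxE; case: leqP => [le | gt]; last by rewrite mulr0 ffact_small.
by rewrite -(ffact_fact le) natrM mulfK // pnatr_eq0 -lt0n fact_gt0.
Qed.

Definition beta_disc l : nat := (\prod_i \prod_(j | (l j < l i)%N) (l i - l j))%N.

(** Used to pass from the pairs ordered by index to the pairs ordered by the values of [l]: the two
    products have the same square. *)
Lemma prod_tournament (D : 'I_N -> 'I_N -> nat) (R : rel 'I_N) :
    (forall i j, D i j = D j i) -> (forall i, ~~ R i i) -> (forall i j, i != j -> R i j (+) R j i) ->
  ((\prod_i \prod_(j | R i j) D i j) ^ 2 = \prod_i \prod_(j | j != i) D i j)%N.
Proof.
move=> Dsym irrR totR; rewrite -mulnn {2}(eq_bigr (fun i => \prod_j if R i j then D i j else 1%N)%N); last first.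
  by move=> i _; rewrite big_mkcond.
rewrite exchange_big -big_split /=; apply: eq_bigr => i _.
rewrite -[X in (_ * X)%N]big_mkcond [X in (X * _)%N]big_mkcond [X in (_ * X)%N]big_mkcond -big_split.
rewrite [RHS]big_mkcond; apply: eq_bigr => j _ /=.
have [-> | nji] := eqVneq j i; first by rewrite (negPf (irrR i)).
have := totR j i nji; rewrite (Dsym j i).
by case: (R i j); case: (R j i); rewrite ?muln1 ?mul1n.
Qed.

Lemma norm_det_inv_fact l : injective l ->
  (\prod_i (l i)`!)%:R * `|\det (inv_fact_mx l)| = (beta_disc l)%:R.
Proof.
move=> injl; rewrite -[X in X * _]normr_nat -normrM det_inv_fact.
pose D i j := (maxn (l i) (l j) - minn (l i) (l j))%N.
have -> : `|\prod_(i < N) \prod_(j < N | (i < j)%N) ((l j)%:R - (l i)%:R)| =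
    (\prod_(i < N) \prod_(j < N | (i < j)%N) D i j)%:R :> algC.
  rewrite normr_prod natr_prod; apply: eq_bigr => i _.
  rewrite normr_prod natr_prod; apply: eq_bigr => j _.
  rewrite /D; case: (leqP (l i) (l j)) => [le | /ltnW le].
    by rewrite (natrB _ le) ger0_norm // subr_ge0 ler_nat.
  by rewrite distrC (natrB _ le) ger0_norm // subr_ge0 ler_nat.
congr _%:R; apply/eqP; rewrite -(eqn_exp2r _ _ (_ : 0 < 2)%N) //; apply/eqP.
have Dsym i j : D i j = D j i by rewrite /D maxnC minnC.
rewrite (@prod_tournament D (fun i j => i < j)%N) //; first last.
- by move=> i j; rewrite -val_eqE /=; case: ltngtP.
- by move=> i; rewrite ltnn.
rewrite -(@prod_tournament D (fun i j => l j < l i)%N) //; first last.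
- by move=> i j; rewrite -(inj_eq injl); case: ltngtP.
- by move=> i; rewrite ltnn.
congr (_ ^ _)%N; apply: eq_bigr => i _; apply: eq_bigr => j ltji.
by rewrite /D (maxn_idPl (ltnW ltji)) (minn_idPr (ltnW ltji)).
Qed.

End Degrees.

(** * Valuations of the degrees of the symmetric group *)

Lemma logn_sum_dvd p x K : prime p -> (0 < x < K)%N ->
  logn p x = (\sum_(1 <= k < K) (p ^ k %| x))%N.
Proof.
move=> p_pr /andP[x_gt0 ltxK]; rewrite logn_count_dvd //.
rewrite [RHS](big_cat_nat x_gt0 (ltnW ltxK)) /= [X in (_ + X)%N]big_nat_cond.
rewrite [X in (_ + X)%N]big1 ?addn0 // => k /andP[/andP[lexk _] _].
by apply/eqP; rewrite eqb0 gtnNdvd // (leq_ltn_trans lexk) // ltn_expl // prime_gt1.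
Qed.

Lemma logn_fact_sum p x K : prime p -> (x < K)%N ->
  logn p x`! = (\sum_(1 <= k < K) x %/ p ^ k)%N.
Proof.
move=> p_pr ltxK; rewrite logn_fact //.
rewrite [RHS](big_cat_nat (ltn0Sn x) ltxK) /= [X in (_ + X)%N]big_nat_cond.
rewrite [X in (_ + X)%N]big1 ?addn0 // => k /andP[/andP[ltxk _] _].
by apply: divn_small; rewrite (ltn_trans ltxk) // ltn_expl // prime_gt1.
Qed.

Lemma logn_prod_pos (I : finType) (P : pred I) (F : I -> nat) p : (forall i, P i -> 0 < F i)%N ->
  logn p (\prod_(i | P i) F i) = (\sum_(i | P i) logn p (F i))%N.
Proof.
move=> F0; apply: (proj2 (_ : (0 < \prod_(i | P i) F i)%N /\ _)).
elim/big_rec2: _ => [|i x y Pi [x0 <-]]; first by rewrite logn1.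
by rewrite muln_gt0 F0 // lognM ?F0.
Qed.

Lemma hook_val_sum p J K : prime p -> (J < K)%N ->
  (hook_val p J <= \sum_(1 <= k < K | p ^ k %| p ^ J) p ^ J %/ p ^ k)%N.
Proof.
move=> p_pr ltJK; have p_gt1 := prime_gt1 p_pr.
rewrite (big_cat_nat (ltn0Sn J) ltJK) /=; apply: leq_trans (leq_addr _ _).
rewrite big_add1 /= big_mkord /hook_val (reindex_inj rev_ord_inj) /= [leqRHS]big_mkcond.
apply: leq_sum => i _; rewrite dvdn_exp2l // -expnB ?(ltnW p_gt1) //.
Qed.

Lemma card_porbits1 n : #|porbits (1%g : {perm 'I_n})| = n.
Proof.
rewrite card_imset ?cardT ?size_enum_ord // => t u; rewrite !porbit1.
exact: set1_inj.
Qed.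

(** The valuation of chi(1) prod_i l_i! = n! prod_(l_j < l_i) (l_i - l_j), by Legendre's formula,
    expresses v_p(n! / chi(1)) as the sum over q = p^k of the quotients minus the ranks of [l]
    modulo q. Each summand is bounded by [residue_rank_bound]. *)
Lemma logn_irr_Sym_bound n p (chi : 'CF([set: {perm 'I_n}])) (g : {perm 'I_n}) :
    (0 < n)%N -> prime p -> chi \in irr [set: {perm 'I_n}] -> p.-elt g -> chi g != 0 ->
  (logn p (chardeg chi) + cycle_weight p g <= logn p n`!)%N.
Proof.
move=> n_gt0 p_pr irr_chi pg nzg; have p_gt0 := prime_gt0 p_pr.
have [l [injl sl chiE]] := irr_beta_char n_gt0 irr_chi.
have normE h : `|chi h| = `|beta_char l h| by case: chiE => ->; rewrite ?normrN.
have x0 := Ordinal n_gt0.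
have betaE h cs : perm_eq cs (enum (porbits h)) ->
    beta_char l h = beta_sum l [seq #|c| | c : {set 'I_n} <- cs].
  by move=> cs_h; rewrite /beta_char (sum_fixed_words x0 (alt_eps l) cs_h).
have chi1_ge0 : 0 <= chi 1%g by rewrite char1_ge0 // irrWchar.
have degE : (chardeg chi * \prod_i (l i)`! = n`! * beta_disc l)%N.
  apply/eqP; rewrite -(eqr_nat algC) !natrM (chardegK (irrWchar irr_chi)).
  rewrite -[chi 1%g]ger0_norm // normE (betaE _ _ (perm_refl _)).
  have -> : [seq #|c| | c : {set 'I_n} <- enum (porbits (1%g : {perm 'I_n}))] = nseq n 1%N.
    have -> : nseq n 1%N = nseq (size [seq #|c| | c : {set 'I_n} <- enum (porbits (1%g : {perm 'I_n}))]) 1%N.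
      by rewrite size_map -cardE card_porbits1.
    apply/all_pred1P/allP => x /mapP[c].
    by rewrite mem_enum => /imsetP[t _ ->] ->; rewrite porbit1 cards1 /=.
  rewrite beta_sum_nseq1 // normrM normr_nat -mulrA [`|_| * _]mulrC norm_det_inv_fact //.
have chi1 : chi 1%g != 0 by case/irrP: irr_chi => i ->; apply: irr1_neq0.
have deg_gt0 : (0 < chardeg chi)%N.
  by rewrite -(ltr_nat algC) chardegK ?irrWchar // lt0r chi1.
(* A common strict bound on all numbers involved, so that their valuations are sums over one range
   of k. *)
pose K := (n + \sum_i l i).+1.
have ltlK i : (l i < K)%N by rewrite /K ltnS (bigD1 i) //= addnCA leq_addr.
have ltnK : (n < K)%N by rewrite ltnS leq_addr.
have K_gt0 : (0 < K)%N by [].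
move: K ltlK ltnK K_gt0 => K ltlK ltnK K_gt0.
have prodf_gt0 : (0 < \prod_i (l i)`!)%N by apply: prodn_gt0 => i; apply: fact_gt0.
have disc_gt0 : (0 < beta_disc l)%N.
  by rewrite -(ltn_pmul2l (fact_gt0 n)) muln0 -degE muln_gt0 deg_gt0.
have := congr1 (logn p) degE; rewrite !lognM ?fact_gt0 // logn_prod_pos => [|i _]; last exact: fact_gt0.
under eq_bigr => i _ do rewrite (logn_fact_sum p_pr (ltlK i)).
have -> : logn p (beta_disc l) = (\sum_(1 <= k < K) \sum_i residue_rank (p ^ k) l i)%N.
  rewrite /beta_disc logn_prod_pos => [|i _]; last by apply: prodn_cond_gt0 => j; rewrite subn_gt0.
  rewrite exchange_big; apply: eq_bigr => i _.
  rewrite logn_prod_pos => [|j]; last by rewrite subn_gt0.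
  rewrite (eq_bigr (fun j => \sum_(1 <= k < K) (p ^ k %| l i - l j)))%N => [|j ltji]; last first.
    by apply: logn_sum_dvd => //; rewrite subn_gt0 ltji (leq_ltn_trans (leq_subr _ _)).
  rewrite exchange_big; apply: eq_bigr => k _; rewrite /residue_rank -sum1_card big_mkcond [RHS]big_mkcond.
  apply: eq_bigr => j _; rewrite inE; case ltji: (l j < l i)%N => //=.
  by rewrite -(eqn_mod_dvd _ (ltnW ltji)) eq_sym; case: (_ == _ %[mod _])%N.
rewrite exchange_big /= => degL.
have leB : (\sum_(1 <= k < K) (\sum_i residue_rank (p ^ k) l i
     + \sum_(c in porbits g | (p ^ k %| #|c|)%N) #|c| %/ p ^ k)
   <= \sum_(1 <= k < K) \sum_i l i %/ p ^ k)%N.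
  apply: leq_sum => k _; have : (0 < p ^ k)%N by rewrite expn_gt0 p_gt0.
  move: (p ^ k)%N => q q_gt0.
  (* The cycles of length divisible by q are to be removed first. *)
  pose s1 := [seq c : {set 'I_n} <- enum (porbits g) | (q %| #|c|)%N].
  pose s2 := [seq c : {set 'I_n} <- enum (porbits g) | ~~ (q %| #|c|)%N].
  have bE : beta_sum l ([seq #|c| | c : {set 'I_n} <- s1] ++ [seq #|c| | c : {set 'I_n} <- s2]) != 0.
    rewrite -map_cat -(betaE g); first by rewrite -normr_eq0 -normE normr_eq0.
    by rewrite /s1 /s2; apply/permPl/perm_filterC.
  have := residue_rank_bound q_gt0 _ bE.
  rewrite big_map big_filter big_enum_cond /=; apply.
  by rewrite all_map; apply/allP=> c; rewrite mem_filter => /andP[].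
rewrite big_split /= in leB.
have leW : (cycle_weight p g <= \sum_(1 <= k < K) \sum_(c in porbits g | p ^ k %| #|c|) #|c| %/ p ^ k)%N.
  rewrite (exchange_big_dep (fun c => c \in porbits g)) /=; last by move=> k c _ /andP[].
  apply: leq_sum => c gc; have cE : #|c| = (p ^ logn p #|c|)%N.
    by rewrite -p_part part_pnat_id // (porbit_card_pnat pg).
  have ltJ : (logn p #|c| < K)%N.
    case: (posnP #|c|) => [->|c_gt0]; first by rewrite logn0.
    rewrite (leq_ltn_trans _ ltnK) // ltnW // (leq_trans (ltn_logl _ c_gt0)) //.
    by apply: leq_trans (max_card _) _; rewrite card_ord.
  have := hook_val_sum p_pr ltJ; rewrite -cE => le_hook; apply: leq_trans le_hook _.
  by rewrite big_mkcond [leqRHS]big_mkcond; apply: leq_sum => k _ /=; case: ifP => //; rewrite gc.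
rewrite -(leq_add2r (\sum_(1 <= k < K) \sum_i residue_rank (p ^ k) l i)) -degL -addnA leq_add2l.
by rewrite addnC; apply: leq_trans leB; rewrite leq_add2l.
Qed.

(** * Alternating groups *)

Section OddCentralizer.
Variable T : finType.
Implicit Types (g h u : {perm T}) (x y : T).

Lemma porbit_restr g (c : {set T}) x : c \in porbits g ->
  porbit (restr_perm c g) x = if x \in c then c else [set x].
Proof.
case/imsetP=> z _ ->.
have Ng : g \in 'N(porbit g z | 'P).
  by rewrite porbitE; apply: (subsetP (acts_orbit _ _ _)); rewrite ?subsetT ?cycle_id.
have restrE y i : y \in porbit g z -> (restr_perm (porbit g z) g ^+ i)%g y = (g ^+ i)%g y.
  move=> cy; elim: i => [|i IHi]; first by rewrite !expg0.
  rewrite !expgSr !permM IHi restr_permE //.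
  by rewrite -eq_porbit_mem porbit_perm eq_porbit_mem.
case: ifP => [cx | ncx].
  have := cx; rewrite -eq_porbit_mem => /eqP <-; apply/setP=> y.
  by apply/porbitP/porbitP=> -[i ->]; exists i; move: (restrE x i cx); rewrite -eq_porbit_mem in cx;
    rewrite (eqP cx).
apply/setP=> y; rewrite inE.
have fixx : restr_perm (porbit g z) g x = x.
  by apply: (out_perm (restr_perm_on _ _)); rewrite ncx.
apply/porbitP/eqP => [[i ->] | ->]; last by exists 0%N; rewrite perm1.
by elim: i => [|i IHi]; rewrite ?perm1 // expgSr permM IHi.
Qed.

Lemma odd_restr_porbit g (c : {set T}) : c \in porbits g ->
  odd_perm (restr_perm c g) = odd #|c|.-1.
Proof.
move=> gc; have c0 : (0 < #|c|)%N by case/imsetP: gc => z _ ->; rewrite lt0n card_porbit_neq0.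
rewrite /odd_perm.
have -> : porbits (restr_perm c g) = c |: [set [set x] | x in ~: c].
  apply/setP=> B; rewrite !inE; apply/imsetP/orP => [[x _ ->] | ].
    rewrite porbit_restr //; case: ifP => [_ | ncx]; [by left | right].
    by apply: imset_f; rewrite inE ncx.
  case=> [/eqP -> | /imsetP[x]].
    by case/card_gt0P: c0 => x cx; exists x; rewrite // porbit_restr // cx.
  by rewrite inE => /negPf ncx ->; exists x; rewrite // porbit_restr // ncx.
rewrite cardsU1 card_imset; last exact: set1_inj.
have -> : c \notin [set [set x] | x in ~: c].
  by apply/imsetP=> -[x]; rewrite inE => ncx cE; rewrite cE inE eqxx in ncx.
rewrite -(cardsC c) -[X in odd (X + _)](prednK c0) addSn /= !oddD.
by case: (odd _.-1); case: (odd #|_|).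
Qed.

(** A nontrivial cycle of g has even length, so it is odd, and it commutes with g; if there is none,
    g = 1 and any transposition will do. *)
Lemma even_cycle_odd_commute g : (1 < #|T|)%N -> 2%N.-elt g ->
  exists2 u, odd_perm u & commute g u.
Proof.
move=> T_gt1 g2; have [c /andP[gc c_gt1] | all1] := pickP (fun c => (c \in porbits g) && (1 < #|c|)%N).
  exists (restr_perm c g); last by apply/commute_sym/restr_perm_commute.
  rewrite odd_restr_porbit //; have := porbit_card_pnat g2 gc; case/p_natP=> // J cJ.
  case: J cJ c_gt1 => [-> // | J -> _].
  by rewrite -subn1 oddB ?expn_gt0 // oddX.
have /card_gt1P[x [y [_ _ nxy]]] := T_gt1.
exists (tperm x y); first by rewrite odd_tperm.
suff -> : g = 1%g by apply/commute_sym/commute1.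
apply/permP=> z; rewrite perm1; have := all1 (porbit g z); rewrite imset_f //= => /negbT.
rewrite -leqNgt => le1; have /card_le1_eqP := le1.
by apply; rewrite ?porbit_id // -{1}[g]expg1 mem_porbit.
Qed.

(** The permutation exchanging g^i x with g^i y for all i is a product of an odd number r of
    transpositions. Conjugation by g shifts these cyclically, and the first commutes with the
    others. *)
Lemma equal_orbits_odd_commute g x y :
    odd #|porbit g x| -> #|porbit g x| = #|porbit g y| -> porbit g x != porbit g y ->
  exists2 u, odd_perm u & commute g u.
Proof.
move=> odd_r eq_r neq_xy; set r := #|porbit g x| in odd_r eq_r.
pose t i := tperm ((g ^+ i)%g x) ((g ^+ i)%g y).
have r_gt0 : (0 < r)%N := odd_gt0 odd_r.
have neq_orb i j : ((g ^+ i)%g x == (g ^+ j)%g y) = false.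
  apply: contraNF neq_xy => /eqP E; have := porbit_perm g i x; rewrite E porbit_perm => ->; exact: eqxx.
have neq_xi i : (x == (g ^+ i)%g y) = false by have := neq_orb 0%N i; rewrite expg0 perm1.
have neq_yi i : (y == (g ^+ i)%g x) = false by have := neq_orb i 0%N; rewrite expg0 perm1 eq_sym.
have uniq_orb z i : (0 < i < #|porbit g z|)%N -> (z == (g ^+ i)%g z) = false.
  case/andP=> i_gt0 ltir; have := nth_uniq z _ _ (uniq_traject_porbit g z).
  move/(_ 0%N i); rewrite !size_traject => /(_ (ltn_trans i_gt0 ltir) ltir).
  by rewrite !nth_traject ?(ltn_trans i_gt0 ltir) // -!permX expg0 perm1 => ->; rewrite ltn_eqF.
pose v := (\prod_(1 <= i < r) t i)%g.
have vE : (\prod_(0 <= i < r) t i = t 0%N * v)%g by rewrite big_ltn.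
have t0v : commute (t 0%N) v.
  rewrite /v big_nat; apply: (big_ind (commute (t 0%N))) => [|a b|i ltir]; first exact: commute1.
    by apply: commuteM.
  apply/commute_sym; rewrite /commute conjgC; congr (_ * _)%g.
  rewrite {1}/t tpermJ /t !expg0 !perm1.
  have ltir' := ltir; rewrite eq_r in ltir'.
  by rewrite !tpermD ?uniq_orb ?neq_xi ?neq_yi.
have trE : t r = t 0%N by rewrite /t {2}eq_r !permX !iter_porbit.
exists (\prod_(0 <= i < r) t i)%g.
  rewrite big_mkord (big_morph _ (@odd_permM T) (odd_perm1 T)).
  rewrite (eq_bigr (fun=> true)) => [|i _]; last by rewrite odd_tperm neq_orb.
  rewrite big_const_ord; suff -> k : iter k (addb true) false = odd k by [].
  by elim: k => //= k ->.
rewrite /commute [RHS]conjgC; congr (_ * _)%g.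
rewrite (big_morph (conjg^~ g) (fun a b => conjMg a b g) (conj1g g)).
rewrite [RHS](eq_bigr (fun i => t i.+1)) => [|i _]; last by rewrite /= /t tpermJ -!permM -!expgSr.
have -> : (\prod_(0 <= i < r) t i.+1 = \prod_(1 <= i < r.+1) t i)%g by rewrite big_add1.
by rewrite big_nat_recr //= -/v trE vE.
Qed.

End OddCentralizer.

(** The odd t can be replaced by the even u^-1 t without changing the conjugate of g. *)
Lemma no_odd_commute n (eta : 'CF('Alt_('I_n))) (g t u : {perm 'I_n}) :
    g \in 'Alt_('I_n) -> odd_perm t -> odd_perm u -> commute g u ->
  eta (g ^ t)%g = eta g.
Proof.
move=> Ag odd_t odd_u cgu.
have -> : (g ^ t = g ^ (u^-1 * t))%g.
  by rewrite conjgM; congr (_ ^ t)%g; rewrite conjgE invgK mulgA -cgu mulgK.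
by rewrite cfunJ // Alt_even odd_permM odd_permV odd_t odd_u.
Qed.

(** * Elements of prime power order with distinct cycle lengths *)

Definition distinct_orbits (T : finType) (g : {perm T}) :=
  forall x y, #|porbit g x| = #|porbit g y| -> porbit g x = porbit g y.

(** A permutation u commuting with g maps each orbit to one of the same length, hence to itself, and
    acts there as a power of g. So the order of u divides that of g. *)
Lemma distinct_orbits_centralizer (T : finType) (p : nat) (g : {perm T}) :
  p.-elt g -> distinct_orbits g -> p.-group 'C[g].
Proof.
move=> pg dg; apply/pgroupP=> q q_pr /(Cauchy q_pr)[u cgu ordu].
have {}cgu : commute g u by apply/commute_sym/cent1P.
have uX i y : u ((g ^+ i)%g y) = (g ^+ i)%g (u y).
  by have /(congr1 (fun s : {perm T} => s y)) := commuteX i (commute_sym cgu); rewrite !permM.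
have u1 : (u ^+ #[g] = 1)%g.
  apply/permP=> x; rewrite perm1.
  have : u x \in porbit g x.
    rewrite -eq_porbit_mem; apply/eqP/dg.
    have -> : porbit g (u x) = u @: porbit g x.
      apply/setP=> y; apply/porbitP/imsetP => [[i ->] | [z /porbitP[i ->] ->]].
        by exists ((g ^+ i)%g x); rewrite ?mem_porbit ?uX.
      by exists i; rewrite uX.
    by rewrite card_imset //; apply: perm_inj.
  case/porbitP=> i ux.
  have uk k : (u ^+ k)%g x = (g ^+ (i * k))%g x.
    elim: k => [|k IHk]; first by rewrite muln0 !expg0.
    by rewrite expgSr permM IHk uX ux mulnS expgD permM.
  by rewrite uk mulnC expgM expg_order expg1n perm1.
have : (q %| #[g])%N by rewrite -ordu order_dvdn u1.
by move/(pgroupP pg) => /(_ q_pr).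
Qed.

Lemma binary_expansion_inj p M (a b : nat -> bool) : (1 < p)%N ->
  (\sum_(k < M) a k * p ^ k = \sum_(k < M) b k * p ^ k)%N -> forall k, (k < M)%N -> a k = b k.
Proof.
move=> p_gt1; elim: M a b => [|M IHM] a b // eqs.
have shift (c : nat -> bool) : (\sum_(k < M.+1) c k * p ^ k = (\sum_(k < M) c k.+1 * p ^ k) * p + c 0)%N.
  rewrite big_ord_recl expn0 muln1 addnC; congr (_ + _)%N; rewrite big_distrl /=.
  by apply: eq_bigr => k _; rewrite expnSr mulnA.
have ltc (c : bool) : (c < p)%N by case: c => //; apply: ltnW.
rewrite !shift in eqs.
have eq0 : a 0%N = b 0%N :> nat.
  by have := congr1 (modn^~ p) eqs; rewrite !modnMDl !modn_small.
move: eqs; rewrite eq0 => /eqP; rewrite eqn_add2r eqn_pmul2r ?(ltnW p_gt1) // => /eqP E.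
have eqk := IHM (fun k => a k.+1) (fun k => b k.+1) E.
by case=> [_ | k]; [case: (a 0%N) (b 0%N) eq0 => [] [] | apply: eqk].
Qed.

Lemma sum_card_porbits n (g : {perm 'I_n}) : (\sum_(c in porbits g) #|c| = n)%N.
Proof.
have [_ _ cov] := porbits_pairwise (perm_refl (enum (porbits g))).
have trivP : trivIset (porbits g).
  apply/trivIsetP=> c d /imsetP[x _ ->] /imsetP[y _ ->].
  apply: contraR => /pred0Pn[z /= /andP[xz yz]].
  by rewrite -!eq_porbit_mem in xz yz; rewrite -(eqP xz) (eqP yz).
have := eqP trivP; rewrite /cover => ->.
move: cov; rewrite big_enum /= => ->; by rewrite cardsT card_ord.
Qed.

Definition cycle_type n (g : {perm 'I_n}) := [seq #|c| | c : {set 'I_n} <- enum (porbits g)].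

Lemma distinct_cycle_type_uniq n (g : {perm 'I_n}) : distinct_orbits g -> uniq (cycle_type g).
Proof.
move=> dg; rewrite map_inj_in_uniq ?enum_uniq // => c d.
by rewrite !mem_enum => /imsetP[x _ ->] /imsetP[y _ ->]; apply: dg.
Qed.

Lemma cycle_type_pnat n p (g : {perm 'I_n}) r : prime p -> p.-elt g -> r \in cycle_type g ->
  exists2 k, (k < n)%N & r = (p ^ k)%N.
Proof.
move=> p_pr pg /mapP[c]; rewrite mem_enum => gc ->.
have /p_natP[k cE] := porbit_card_pnat pg gc; exists k => //.
have : (#|c| <= n)%N by apply: leq_trans (max_card _) _; rewrite card_ord.
by rewrite cE; apply: leq_trans; rewrite ltn_expl // prime_gt1.
Qed.

Lemma distinct_cycle_type_expansion n p (g : {perm 'I_n}) : prime p -> p.-elt g -> distinct_orbits g ->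
  (\sum_(k < n) ((p ^ k)%N \in cycle_type g) * p ^ k = n)%N.
Proof.
move=> p_pr pg dg; rewrite -[RHS](sum_card_porbits g).
have -> : (\sum_(c in porbits g) #|c| = \sum_(r <- cycle_type g) r)%N by rewrite big_map big_enum.
rewrite [RHS](eq_big_seq (fun r => \sum_(k < n) (r == p ^ k) * p ^ k))%N => [|r /(cycle_type_pnat p_pr pg)[k ltk ->]].
  rewrite exchange_big; apply: eq_bigr => k _ /=; rewrite -big_distrl /=; congr (_ * _)%N.
  rewrite -(count_uniq_mem _ (distinct_cycle_type_uniq dg)) -sum1_count big_mkcond.
  by apply: eq_bigr => r _ /=; case: eqP.
rewrite (bigD1 (Ordinal ltk)) //= eqxx mul1n big1 ?addn0 // => j.
rewrite -val_eqE /= eq_sym => njk; rewrite eqn_exp2l ?prime_gt1 //.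
by rewrite (negPf njk).
Qed.

(** The cycle lengths are distinct powers of p, hence given by the expansion of n in base p. Equal
    cycle types make all irreducible characters agree at g and h, by [irr_beta_char], and column
    orthogonality then gives conjugacy. *)
Lemma distinct_orbits_conj n p (g h : {perm 'I_n}) : (0 < n)%N -> prime p ->
    p.-elt g -> p.-elt h -> distinct_orbits g -> distinct_orbits h ->
  h \in (g ^: [set: {perm 'I_n}])%g.
Proof.
move=> n_gt0 p_pr pg ph dg dh.
have eq_type : perm_eq (cycle_type g) (cycle_type h).
  have eq_mem k : (k < n)%N -> ((p ^ k)%N \in cycle_type g) = ((p ^ k)%N \in cycle_type h).
    apply: (@binary_expansion_inj p n (fun k => (p ^ k)%N \in cycle_type g) (fun k => (p ^ k)%N \in cycle_type h)).
      exact: prime_gt1.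
    by rewrite !distinct_cycle_type_expansion.
  apply: uniq_perm; rewrite ?distinct_cycle_type_uniq // => r; apply/idP/idP => rg.
    by have [k ltk E] := cycle_type_pnat p_pr pg rg; rewrite E in rg *; rewrite -eq_mem.
  by have [k ltk E] := cycle_type_pnat p_pr ph rg; rewrite E in rg *; rewrite eq_mem.
pose cs (u : {perm 'I_n}) := sort (relpre (fun c : {set 'I_n} => #|c|) leq) (enum (porbits u)).
have eq_cs : [seq #|c| | c : {set 'I_n} <- cs g] = [seq #|c| | c : {set 'I_n} <- cs h].
  rewrite -!sort_map; apply/perm_sortP => //; [exact: leq_total | exact: leq_trans | exact: anti_leq].
have eq_beta (l : {ffun 'I_n -> nat}) : beta_char l g = beta_char l h :> algC.
  have x0 := Ordinal n_gt0.
  rewrite /beta_char (sum_fixed_words x0 (alt_eps l) (_ : perm_eq (cs g) _)) ?perm_sort //.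
  rewrite (sum_fixed_words x0 (alt_eps l) (_ : perm_eq (cs h) _)) ?perm_sort //.
  by rewrite eq_cs.
have eq_irr i : 'chi[[set: {perm 'I_n}]%G]_i g = 'chi_i h.
  by have [l [_ _ [] E]] := irr_beta_char n_gt0 (mem_irr i); rewrite !E eq_beta.
have := second_orthogonality_relation h (in_setT g : g \in [set: {perm 'I_n}]%G).
case: (h \in _) => //; rewrite mulr0n => /eqP.
rewrite (eq_bigr (fun i => 'chi[[set: {perm 'I_n}]%G]_i g * ('chi_i g)^*)) => [|i _]; last by rewrite eq_irr.
rewrite psumr_eq0 => [/allP/(_ 0 (mem_index_enum _)) | i _]; last exact: mul_conjC_ge0.
by rewrite mul_conjC_eq0 irr0 cfun1E inE oner_eq0.
Qed.

(* Both sides count the s in G with x ^ s in P; u is the number of fixed points of x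
   on the cosets of P, hence it is congruent to |G : P| modulo p. *)
Lemma card_Sylow_class (gT : finGroupType) (p : nat) (G P : {group gT}) (x : gT) :
    prime p -> p.-Sylow(G) P -> x \in G -> p.-elt x ->
  exists2 u, ~~ (p %| u)%N & (#|P :&: (x ^: G)| * #|'C_G[x]| = #|P| * u)%N.
Proof.
move=> p_pr sylP Gx px; have sPG := pHall_sub sylP.
pose Fix := 'Fix_(rcosets P G | 'Rs)(<[x]>).
exists #|Fix|.
  have acts_x : [acts <[x]>, on rcosets P G | 'Rs].
    by apply: subset_trans (actsRs_rcosets P G); rewrite cycle_subG.
  rewrite /dvdn -(pgroup_fix_mod px acts_x) -/(dvdn _ _).
  by case/and3P: sylP => _ _; rewrite -p'natE.
pose Y := [set s in G | (x ^ s)%g \in P].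
transitivity #|Y|.
  rewrite -[#|Y|]sum1_card (partition_big (fun s => x ^ s)%g (mem (P :&: (x ^: G)))) /=; last first.
    by move=> s; rewrite !inE => /andP[Gs ->]; rewrite memJ_class.
  rewrite -sum_nat_const; apply: eq_bigr => y; rewrite inE => /andP[Py /imsetP[s Gs yE]].
  rewrite sum1dep_card -(card_rcoset 'C_G[x]%G s); apply: eq_card => v.
  rewrite mem_rcoset in_setI groupMr ?groupV // [RHS]inE [v \in Y]inE; case Gv: (v \in G) => //=.
  have -> : ((v * s^-1)%g \in 'C[x]%g) = ((x ^ v)%g == (x ^ s)%g).
    apply/cent1P/eqP => [cxw | eqv]; last first.
      by apply/commute_sym/commgP/conjg_fixP; rewrite conjgM eqv -conjgM mulgV conjg1.
    by rewrite -[v in LHS](mulgKV s) conjgM; congr (_ ^ s)%g; apply/conjg_fixP/commgP/commute_sym.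
  by rewrite -yE; case: eqP => [->|]; rewrite ?andbF // Py.
have sum_fix : (#|Y| = \sum_(v in G) ((x ^ v^-1)%g \in P))%N.
  rewrite -sum1_card (reindex_inj invg_inj) /= big_mkcond [RHS]big_mkcond.
  by apply: eq_bigr => v _; rewrite inE groupV; case: (v \in G) => //=; case: (_ \in _).
rewrite sum_fix (set_partition_big _ (rcosets_partition sPG)) /=.
(* For v in G, the conjugate of x by v^-1 lies in P exactly when x fixes the coset P v; so the
   condition is constant on cosets. *)
rewrite (eq_bigr (fun X => #|P| * (X \in afix 'Rs [set x]))%N) => [|X /rcosetsP[v Gv ->]]; last first.
  rewrite (eq_bigr (fun=> ((P :* v)%g \in afix 'Rs [set x]) : nat)).
    by rewrite sum_nat_const card_rcoset.
  move=> w /rcosetP[z Pz ->]; congr nat_of_bool.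
  rewrite invMg conjgM groupJr ?groupV //; apply/idP/afix1P => /= [xvP | fixX].
    by rewrite rcosetE -rcosetM; apply/rcoset_eqP; rewrite mem_rcoset -mulgA -[(x * _)%g]/(x * v^-1)%g; move: xvP; rewrite conjgE invgK.
  have : (v * x)%g \in (P :* v)%g by rewrite -fixX rcosetE -rcosetM rcoset_refl.
  by rewrite mem_rcoset conjgE invgK mulgA.
rewrite -big_distrr /=; congr (_ * _)%N; rewrite -sum1_card big_mkcond [RHS]big_mkcond.
by apply: eq_bigr => X _; rewrite in_setI afix_cycle; case: (X \in rcosets P G) => //=; case: ifP => [->|->].
Qed.

Lemma odd_permX (T : finType) (g : {perm T}) k : odd_perm (g ^+ k)%g = odd k && odd_perm g.
Proof.
elim: k => [|k IHk]; first by rewrite odd_perm1.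
by rewrite expgS odd_permM IHk /=; case: (odd k); case: (odd_perm g).
Qed.

Lemma odd_pelt_even (T : finType) p (g : {perm T}) : odd p -> p.-elt g -> g \in 'Alt_T.
Proof.
move=> odd_p pg; have odd_g : odd #[g] by case/p_natP: pg => k ->; rewrite oddX odd_p orbT.
by have := odd_permX g #[g]; rewrite expg_order odd_perm1 odd_g Alt_even => /esym/negbT.
Qed.

Lemma alt_split_contra n p (eta : 'CF('Alt_('I_n))) (g t : {perm 'I_n}) :
    (0 < n)%N -> prime p -> odd p -> eta \in irr 'Alt_('I_n) -> p.-elt g ->
    odd_perm t -> eta g != 0 -> eta (g ^ t)%g = - eta g -> False.
Proof.
move=> n_gt0 p_pr odd_p irr_eta pg odd_t nz_g eta_gt.
(* Two cycles of equal length, necessarily odd, would give an odd permutation commuting with y. *)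
have distinctP (y : {perm 'I_n}) : p.-elt y -> eta (y ^ t)%g != eta y -> distinct_orbits y.
  move=> py neq x z eq_xz; apply/eqP; apply: contraNT neq => neq_xz.
  have odd_x : odd #|porbit y x|.
    have /p_natP[k ->] : p.-nat #|porbit y x| by apply: (porbit_card_pnat py); apply: imset_f.
    by rewrite oddX odd_p orbT.
  have [u odd_u cyu] := equal_orbits_odd_commute odd_x eq_xz neq_xz.
  by rewrite (no_odd_commute eta (odd_pelt_even odd_p py) odd_t odd_u cyu).
have nz2 : (2%:R : algC) != 0 by rewrite pnatr_eq0.
have dg : distinct_orbits g.
  by apply: (distinctP g pg); rewrite eta_gt -subr_eq0 -opprD oppr_eq0 -mulr2n mulrn_eq0.
pose S := [set: {perm 'I_n}]%G.
have [P sylP sgP] : {P : {group {perm 'I_n}} | p.-Sylow(S) P & <[g]>%g \subset P}.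
  by apply: Sylow_superset; rewrite ?subsetT.
have Pg : g \in P by rewrite -cycle_subG.
have pP := pHall_pgroup sylP.
have PA y : y \in P -> y \in 'Alt_('I_n) by move=> Py; apply: (odd_pelt_even odd_p (mem_p_elt pP Py)).
have sPA : P \subset 'Alt_('I_n) by apply/subsetP.
have Nt : (t^-1)%g \in 'N('Alt_('I_n)).
  by have := normal_norm (Alt_normal 'I_n) => /subsetP; apply; rewrite inE.
pose eta' := (eta ^ t^-1)%CF.
have eta'E y : eta' y = eta (y ^ t)%g by rewrite cfConjgE // invgK.
have irr_eta' : eta' \in irr 'Alt_('I_n) by apply: cfConjg_irr.
pose delta := 'Res[P] eta - 'Res[P] eta'.
have deltaE y : y \in P -> delta y = eta y - eta (y ^ t)%g.
  by move=> Py; rewrite !cfunE !cfResE // eta'E.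
have vdelta : delta \in 'Z[irr P].
  by rewrite rpredB // char_vchar // cfRes_char // irrWchar.
have [k kE] := natrP (Cnat_cfnorm_vchar vdelta).
pose E := eta g * (eta g)^*.
have deltag : delta g = 2%:R * eta g.
  by rewrite deltaE // eta_gt opprK -mulr2n mulr_natl.
have sum_delta : \sum_(y in P) delta y * (delta y)^* = #|P :&: (g ^: S)%g|%:R * (4%:R * E).
  rewrite (big_setID (g ^: S)%g) /= [X in _ + X]big1 ?addr0 => [|y]; last first.
    rewrite !inE => /andP[ngy Py]; rewrite deltaE //.
    have [-> | neq] := eqVneq (eta (y ^ t)%g) (eta y); first by rewrite subrr mul0r.
    have py := mem_p_elt pP Py.
    by case/negP: ngy; apply: (distinct_orbits_conj n_gt0 p_pr pg py dg (distinctP y py neq)).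
  rewrite (eq_bigr (fun=> 4%:R * E)) => [|y]; first by rewrite sumr_const -[LHS]mulr_natl.
  rewrite inE => /andP[Py /imsetP[s _ yE]].
  have AJ (a s0 : {perm 'I_n}) : ~~ odd_perm s0 -> eta (a ^ s0)%g = eta a.
    by move=> even_s; rewrite cfunJ // Alt_even.
  have : delta y = delta g \/ delta y = - delta g.
    rewrite !deltaE // yE; case odd_s: (odd_perm s); [right | left].
      rewrite -conjgM (AJ g (s * t)%g) ?odd_permM ?odd_s ?odd_t // opprB.
      have -> : (g ^ s = (g ^ t) ^ (t^-1 * s))%g by rewrite -conjgM mulKVg.
      by rewrite AJ // odd_permM odd_permV odd_s odd_t.
    rewrite (AJ g s) ?odd_s //; congr (_ - _).
    by rewrite conjJg AJ // odd_permJ odd_s.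
  have E4 : delta g * (delta g)^* = 4%:R * E.
    by rewrite deltag rmorphM /= conjC_nat /E -[4%N]/(2 * 2)%N natrM; ring.
  by case=> ->; rewrite ?rmorphN ?mulrNN -E4.
have [u npu cu] := card_Sylow_class p_pr sylP (in_setT g) pg.
set c := #|'C_S[g]%g| in cu.
set m := #|P :&: (g ^: S)%g| in sum_delta cu.
have P0 : #|P|%:R != 0 :> algC by rewrite pnatr_eq0 -lt0n cardG_gt0.
(* The norm k of [delta] satisfies |P| k = 4 m E; multiply by c and use m c = |P| u. As p is odd and
   does not divide u, the p-power c will have to divide E. *)
have kcE : (k * c)%:R = 4%:R * E * u%:R :> algC.
  apply: (mulfI P0); rewrite natrM mulrA.
  have -> : #|P|%:R * k%:R = m%:R * (4%:R * E).
    by rewrite -sum_delta -kE cfdotE mulVKf.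
  have -> : m%:R * (4%:R * E) * c%:R = (m * c)%:R * (4%:R * E) by rewrite natrM; ring.
  by rewrite cu natrM; ring.
have u_gt0 : (0 < u)%N by rewrite lt0n; apply: contraNneq npu => ->; rewrite dvdn0.
have E_ge0 : 0 <= E by apply: mul_conjC_ge0.
have [e eE] : exists e, E = e%:R.
  apply/natrP; rewrite natrEint E_ge0 andbT; apply: Cint_rat_Aint.
    have -> : E = (k * c)%:R / (4 * u)%:R.
      have -> : (k * c)%:R = E * (4 * u)%:R by rewrite kcE natrM; ring.
      by rewrite mulfK // pnatr_eq0 -lt0n muln_gt0.
    by rewrite rpred_div ?rpred_nat.
  have Ag : eta g \in Aint by apply: Aint_char; apply: irrWchar.
  by apply: rpredM => //; rewrite Aint_aut.
have e_gt0 : (0 < e)%N.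
  by rewrite lt0n -(eqr_nat algC) -eE mul_conjC_eq0.
have dvd_ce : (c %| e)%N.
  have : (c %| 4 * e * u)%N.
    by apply/dvdnP; exists k; apply/eqP; rewrite -(eqr_nat algC) kcE eE !natrM.
  have pc : p.-nat c.
    have := distinct_orbits_centralizer pg dg; rewrite /c setTI. by [].
  rewrite Gauss_dvdl; last by rewrite (pnat_coprime pc) // p'natE.
  rewrite Gauss_dvdr // (pnat_coprime pc) // p'natE // -[4%N]/(2 * 2)%N Euclid_dvdM // orbb.
  by rewrite dvdn_prime2 //; apply: contraTneq odd_p => ->.
have le_ce := dvdn_leq e_gt0 dvd_ce.
(* [eta] and its conjugate are distinct, and each contributes E to the column of g, whose squared
   norm is the order of the centraliser in A_n, at most c. *)
have le_2e : (2 * e <= c)%N.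
  have /irrP[i iE] := irr_eta; have /irrP[j jE] := irr_eta'.
  have nij : j != i.
    apply: contraTneq nz_g => eji; have : eta' g = eta g by rewrite jE iE eji.
    by rewrite eta'E eta_gt => /eqP; rewrite eqNr => ->.
  have := second_orthogonality_relation g (PA g Pg).
  rewrite class_refl mulr1n (bigD1 i) //= (bigD1 j) //= -iE -jE eta'E eta_gt rmorphN mulrNN -/E => sumE.
  have : 2%:R * E <= #|'C_('Alt_('I_n))[g]%g|%:R.
    rewrite -sumE mulr_natl mulr2n lerD2l lerDl; apply: sumr_ge0 => l _; exact: mul_conjC_ge0.
  rewrite eE -natrM ler_nat => /leq_trans; apply.
  by apply: subset_leq_card; rewrite setSI // subsetT.
by have := leq_trans le_2e le_ce; rewrite mul2n -addnn -[leqRHS]add0n leq_add2r leqNgt e_gt0.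
Qed.

(** Either [eta] extends to S_n, or it induces to an irreducible character of degree 2 eta(1); the
    symmetric bound applies unless the induced character vanishes at g. *)
Lemma logn_irr_Alt_bound n p (eta : 'CF('Alt_('I_n))) (g : {perm 'I_n}) :
    (1 < n)%N -> prime p -> eta \in irr 'Alt_('I_n) -> g \in 'Alt_('I_n) -> p.-elt g -> eta g != 0 ->
  (logn p (chardeg eta) + cycle_weight p g <= logn p n`!)%N.
Proof.
move=> n_gt1 p_pr irr_eta Ag pg nzg; have n_gt0 := ltnW n_gt1.
pose S := [set: {perm 'I_n}]%G; pose A := 'Alt_('I_n)%G.
have AE y : (y \in A) = ~~ odd_perm y by apply: Alt_even.
have nAS : A <| S by exact: (Alt_normal 'I_n).
have iAS : #|S : A| = 2 by apply: (Alt_index (T := 'I_n)); rewrite card_ord.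
have /irrP[s sE] := irr_eta.
have [inv | not_inv] := boolP (S \subset 'I['chi_s]%CF).
  have [c cE] := prime_invariant_irr_extendible nAS iAS isT inv.
  have valE x : x \in A -> 'chi_c x = eta x by move=> Ax; rewrite sE -cE cfResE // normal_sub.
  have -> : chardeg eta = chardeg 'chi_c by rewrite /chardeg valE.
  by apply: logn_irr_Sym_bound; rewrite ?mem_irr ?valE.
have [t odd_t not_t] : exists2 t : {perm 'I_n}, odd_perm t & t \notin 'I['chi_s]%CF.
  have [t _ It] := subsetPn not_inv; exists t => //.
  apply: contraNT It => even_t; apply: (subsetP (sub_inertia _)); by rewrite Alt_even.
pose chi := 'Ind[S] eta.
have Nt : (t^-1)%g \in 'N(A) by apply: (subsetP (normal_norm nAS)); rewrite inE.
have Neta : eta \is a character by apply: irrWchar.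
have chiE x : x \in A -> chi x = eta x + eta (x ^ t)%g.
  move=> Ax; rewrite cfIndE ?normal_sub //.
  rewrite (bigID (fun y : {perm 'I_n} => y \in A)) /=.
  have A0 : #|A|%:R != 0 :> algC by rewrite pnatr_eq0 -lt0n cardG_gt0.
  have AJ z y : y \in A -> eta (z ^ y)%g = eta z by move=> Ay; rewrite cfunJ.
  rewrite mulrDr; congr (_ + _).
    rewrite (eq_big (mem A) (fun=> eta x)) => [|y|y /andP[_ Ay]]; last by rewrite AJ.
      by rewrite sumr_const -[eta x *+ _]mulr_natl mulKf.
    by rewrite inE.
  rewrite (reindex_inj (mulgI t)) /= (eq_big (mem A) (fun=> eta (x ^ t)%g)) => [|y|y /andP[_ tyA]].
  - by rewrite sumr_const -[eta _ *+ _]mulr_natl mulKf.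
  - by rewrite in_setT /= !AE odd_permM odd_t negbK addTb.
  by rewrite conjgM [LHS]AJ //; move: tyA; rewrite !AE odd_permM odd_t negbK addTb.
have chi1 : chi 1%g = 2%:R * eta 1%g by rewrite cfInd1 ?normal_sub // iAS.
have Nchi : chi \is a character by apply: cfInd_char.
have irr_chi : chi \in irr S.
  rewrite irrEchar Nchi -Frobenius_reciprocity.
  have -> : 'Res[A] chi = eta + (eta ^ t^-1)%CF.
    apply/cfun_inP=> x Ax; rewrite cfResE ?normal_sub // chiE // !cfunE cfConjgE // invgK //.
  rewrite cfdotDr irrWnorm // sE (cfdot_irr_conjg s nAS (in_setT (t^-1)%g : (t^-1)%g \in S)).
  have -> : ((t^-1)%g \in 'I_S['chi_s]%CF) = false.
    by rewrite in_setI [X in _ && X]groupV (negPf not_t) andbF.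
  by rewrite addr0 eqxx.
have degE : chardeg chi = (2 * chardeg eta)%N.
  by apply/eqP; rewrite -(eqr_nat algC) natrM !chardegK // chi1.
have deg_gt0 : (0 < chardeg eta)%N.
  by rewrite -(ltr_nat algC) chardegK // lt0r char1_ge0 // andbT sE irr1_neq0.
have [chi0 | nz_chi] := eqVneq (chi g) 0; last first.
  apply: leq_trans (logn_irr_Sym_bound n_gt0 p_pr irr_chi pg nz_chi).
  by rewrite leq_add2r degE lognM // leq_addl.
(* The remaining case: the constituents [eta] and its conjugate cancel at g. *)
have eta_gt : eta (g ^ t)%g = - eta g.
  by apply/eqP; rewrite -addr_eq0 addrC -chiE // chi0.
have [p2 | odd_p] := even_prime p_pr; last by case: (alt_split_contra n_gt0 p_pr odd_p irr_eta pg odd_t nzg eta_gt).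
have [u odd_u cgu] : exists2 u, odd_perm u & commute g u.
  by apply: even_cycle_odd_commute; rewrite ?card_ord // -p2.
have := no_odd_commute eta Ag odd_t odd_u cgu; rewrite eta_gt => /eqP.
by rewrite eqNr (negPf nzg).
Qed.

(** * Comparison of two characters on a Sylow subgroup *)

Lemma Sylow_Alt_card n p (Q : {group {perm 'I_n}}) : (1 < n)%N -> prime p ->
  Q \in 'Syl_p('Alt_('I_n)) -> (logn p n`! <= logn p #|Q| + (p == 2))%N.
Proof.
move=> n_gt1 p_pr; rewrite inE => /card_Hall ->; rewrite logn_part.
have -> : n`! = (2 * #|'Alt_('I_n)|)%N by rewrite card_Alt card_ord.
by rewrite lognM ?cardG_gt0 // addnC leq_add2l logn_prime.
Qed.

(** Take g of maximal cycle weight among the elements of Q where [theta] does not vanish, and use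
    that weight as the bound D. *)
Lemma exists_Sylow_nonvanishing n p (Q : {group {perm 'I_n}}) (theta : 'CF('Alt_('I_n))) :
    prime p -> p.-group Q -> Q \subset 'Alt_('I_n) -> theta \in irr 'Alt_('I_n) ->
  exists2 g, g \in Q & theta g != 0 /\ (logn p #|Q| <= logn p (chardeg theta) + cycle_weight p g)%N.
Proof.
move=> p_pr pQ sQA irr_theta; have Ntheta := irrWchar irr_theta.
have deg0 : theta 1%g != 0 by case/irrP: irr_theta => i ->; apply: irr1_neq0.
have deg_gt0 : (0 < chardeg theta)%N.
  by rewrite -(ltr_nat algC) chardegK // lt0r char1_ge0 // andbT.
have P1 : (1%g \in Q) && (theta 1%g != 0) by rewrite group1.
case: (@arg_maxnP _ 1%g (fun g => (g \in Q) && (theta g != 0)) (cycle_weight p) P1) => g /andP[Qg nzg] maxg.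
exists g => //; split=> //.
have degQ : chardeg ('Res[Q] theta) = chardeg theta by rewrite /chardeg cfResE.
have dvdQ : (#|Q| %| p ^ cycle_weight p g * chardeg theta)%N.
  rewrite -degQ; apply: (dvdn_pgroup_char1 p_pr pQ (cfRes_char Q Ntheta)) => h Qh.
  by rewrite cfResE // => nzh; apply: maxg; rewrite Qh.
have pX_gt0 : (0 < p ^ cycle_weight p g)%N by rewrite expn_gt0 prime_gt0.
have := dvdn_leq_log p _ dvdQ; rewrite muln_gt0 pX_gt0 deg_gt0 => /(_ isT).
by rewrite lognM // pfactorK // addnC.
Qed.

(** With s(g) the cycle weight, v_p(eta(1)) + s(g) <= v_p(n!) <= v_p(|Q|) + [p = 2] <= v_p(theta(1))
    + s(g) + [p = 2]. *)
Lemma chardeg_part_le n p (Q : {group {perm 'I_n}}) (eta theta : 'CF('Alt_('I_n))) :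
    prime p -> Q \in 'Syl_p('Alt_('I_n)) -> eta \in irr 'Alt_('I_n) -> theta \in irr 'Alt_('I_n) ->
    Van ('Res[Q] eta) \subset Van ('Res[Q] theta) ->
  (logn p (chardeg eta) <= logn p (chardeg theta) + (p == 2))%N.
Proof.
move=> p_pr sylQ irr_eta irr_theta sub_van.
(* For n <= 1 the group is trivial and the index of A_n is not 2. *)
have [n_le1 | n_gt1] := leqP n 1.
  suff -> : chardeg eta = 1%N by rewrite logn1.
  have A1 : #|'Alt_('I_n)| = 1%N.
    apply/eqP; rewrite eqn_leq cardG_gt0 andbT; apply: leq_trans (max_card _) _.
    by rewrite card_Sn; case: (n) n_le1 => [|[]].
  have abA : abelian 'Alt_('I_n) by rewrite (card1_trivg A1) abelian1.
  have /irrP[i ->] := irr_eta; rewrite /chardeg lin_char1 ?truncn1 //.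
  exact: (char_abelianP _ abA).
have sQA : Q \subset 'Alt_('I_n) by move: sylQ; rewrite inE => /pHall_sub.
have pQ : p.-group Q by move: sylQ; rewrite inE => /pHall_pgroup.
have [g Qg [nzg leQ]] := exists_Sylow_nonvanishing p_pr pQ sQA irr_theta.
have nz_eta : eta g != 0.
  apply: contraNneq nzg => eta0; have : g \in Van ('Res[Q] theta).
    by apply: (subsetP sub_van); rewrite inE Qg cfResE // eta0 eqxx.
  by rewrite inE Qg cfResE.
have le1 := logn_irr_Alt_bound n_gt1 p_pr irr_eta (subsetP sQA g Qg) (mem_p_elt pQ Qg) nz_eta.
have le2 := Sylow_Alt_card n_gt1 p_pr sylQ.
rewrite -(leq_add2r (cycle_weight p g)); apply: leq_trans le1 _; apply: leq_trans le2 _.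
by rewrite addnAC leq_add2r.
Qed.

Local Open Scope nat_scope.

Theorem theoremA2 (n p : nat) (Q : {group {perm 'I_n}})
    (eta theta : 'CF('Alt_('I_n))) :
  prime p ->
  Q \in 'Syl_p('Alt_('I_n)) ->
  eta \in irr 'Alt_('I_n) ->
  theta \in irr 'Alt_('I_n) ->
  (Van ('Res[Q] eta)%R \subset Van ('Res[Q] theta)%R ->
     (odd p -> (chardeg eta)`_p <= (chardeg theta)`_p) /\
     (p = 2 -> (chardeg eta)`_2 <= 2 * (chardeg theta)`_2)) /\
  (Van ('Res[Q] eta)%R = Van ('Res[Q] theta)%R ->
     (odd p -> (chardeg eta)`_p = (chardeg theta)`_p) /\
     (p = 2 ->
      (chardeg theta)`_2 <= (chardeg eta)`_2 ->
      (chardeg eta)`_2 = (chardeg theta)`_2 \/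
      (chardeg eta)`_2 = 2 * (chardeg theta)`_2)).
Proof.
move=> p_pr sylQ irr_eta irr_theta.
have le_odd (xi psi : 'CF('Alt_('I_n))) : xi \in irr 'Alt_('I_n) -> psi \in irr 'Alt_('I_n) ->
    Van ('Res[Q] xi)%R \subset Van ('Res[Q] psi)%R -> odd p -> (chardeg xi)`_p <= (chardeg psi)`_p.
  move=> irr_xi irr_psi sub_van odd_p; rewrite !p_part leq_exp2l ?prime_gt1 //.
  have := chardeg_part_le p_pr sylQ irr_xi irr_psi sub_van.
  by case: eqP odd_p => [-> // | _ _]; rewrite addn0.
have le_two : Van ('Res[Q] eta)%R \subset Van ('Res[Q] theta)%R -> p = 2 ->
    logn 2 (chardeg eta) <= (logn 2 (chardeg theta)).+1.
  by move=> sub_van p2; have := chardeg_part_le p_pr sylQ irr_eta irr_theta sub_van; rewrite p2 eqxx addn1.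
split=> [sub_van | eq_van]; split=> [odd_p | p2].
- exact: le_odd.
- by rewrite !p_part -expnS leq_exp2l // le_two.
- by apply/eqP; rewrite eqn_leq !le_odd // eq_van.
rewrite !p_part leq_exp2l // -expnS => le_log.
have := le_two _ p2; rewrite eq_van subxx => /(_ isT).
by rewrite leq_eqVlt ltnS => /predU1P[-> | le2]; [right | left; congr (2 ^ _); apply/eqP; rewrite eqn_leq le2].
Qed.
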